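(* Let $n=1$, $s\in(0,1)$ and $K(x):=|x|^{-1-2s}$, with associated operator $L_s u(x)=\mathrm{PV}\int_{\mathbb{R}}\frac{u(y)-u(x)}{|x-y|^{1+2s}}\,dy$. Then there exist a potential $W:\mathbb{R}\to[0,+\infty)$ satisfying (W1) $W\in C^{2,\vartheta}_{\rm loc}(\mathbb{R})$ for some $\vartheta>0$, with $W(\pm1)=W'(\pm1)=0$; (W2) $W(t)>0$ for all $t\in(-1,1)$; (W3) there exist $c_2\ge c_1>0$, $c_4\ge c_3>0$, $\mu\in(0,1)$, $\alpha\ge\beta\ge2$ and $\gamma\ge\delta\ge2$ such that $c_1(1+t)^{\alpha-2}\le W''(t)\le c_2(1+t)^{\beta-2}$ for $t\in(-1,-1+\mu]$ and $c_3(1-t)^{\gamma-2}\le W''(t)\le c_4(1-t)^{\delta-2}$ for $t\in[1-\mu,1)$, with exponents satisfying $\max\{\alpha-\beta,\gamma-\delta\}<1$ and $\min\{\beta,\delta\}\ge5$, and a function $\widetilde u\in\mathcal{X}$ such that $L_s\widetilde u=W'(\widetilde u)$ in $\mathbb{R}$. Moreover, there exist positive constants $C_1,C_2$ and diverging sequences of positive real numbers $x_k$, $y_k$, $z_k$ such that $$1-\widetilde u(x_k)=C_2x_k^{-\frac{2s}{\gamma-1}},\quad 1-\widetilde u(y_k)=C_1y_k^{-\frac{2s}{\delta-1}},$$ $$1+\widetilde u(-x_k)=C_2|x_k|^{-\frac{2s}{\alpha-1}},\quad 1+\widetilde u(-y_k)=C_1|y_k|^{-\frac{2s}{\beta-1}},$$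 $$\widetilde u'(z_k)=C_1z_k^{-\left(1+\frac{2s(\gamma-\delta+1)}{\gamma-1}\right)},\quad \widetilde u'(-z_k)=C_1|z_k|^{-\left(1+\frac{2s(\alpha-\beta+1)}{\alpha-1}\right)}.$$
   Context: $\mathcal{X}$ denotes the set of $f\in L^1_{\rm loc}(\mathbb{R})$ with $\lim_{x\to\pm\infty}f(x)=\pm1$. PV denotes the Cauchy principal value. *)

(* Defs.v *)
From HB Require Import structures.
From mathcomp Require Import all_boot all_order all_algebra.
From mathcomp Require Import all_classical all_reals all_analysis.
From mathcomp Require Import Rstruct Rstruct_topology.
Set Implicit Arguments. Unset Strict Implicit. Unset Printing Implicit Defensive.
Import Order.TTheory GRing.Theory Num.Theory.
Import numFieldNormedType.Exports.
Local Open Scope classical_set_scope.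
Local Open Scope ring_scope.

Notation RR := Rdefinitions.R.
Notation leb := (@lebesgue_measure RR).

Definition L1loc (f : RR -> RR) : Prop :=
  forall a b : RR, leb.-integrable `[a, b] (fun y => (f y)%:E).

Definition classX (f : RR -> RR) : Prop :=
  L1loc f /\ f @ +oo --> (1 : RR) /\ f @ -oo --> (-1 : RR).

Definition outside (x eps : RR) : set RR := [set y | eps < `|y - x|].

Definition Ls_integrand (s : RR) (u : RR -> RR) (x y : RR) : RR :=
  (u y - u x) * (`|x - y| `^ (-1 - 2 * s)).

Definition Ls_PV_at (s : RR) (u : RR -> RR) (x l : RR) : Prop :=
  (forall eps : RR, 0 < eps ->
     leb.-integrable (outside x eps) (fun y => (Ls_integrand s u x y)%:E)) /\
  (fun eps : RR => (\int[leb]_(y in outside x eps) (Ls_integrand s u x y)%:E)%E)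
     @ 0^'+ --> (l%:E).

Definition D1 (f : RR -> RR) : RR -> RR := derive1 (f : RR^o -> RR^o).
Definition D2 (f : RR -> RR) : RR -> RR := D1 (D1 f).
Definition dble (f : RR -> RR) (t : RR) : Prop := derivable (f : RR^o -> RR^o) t 1.

Definition C2theta_loc (theta : RR) (W : RR -> RR) : Prop :=
  (forall t : RR, dble W t) /\
  (forall t : RR, dble (D1 W) t) /\
  (forall a b : RR, exists C : RR, forall t1 t2 : RR,
      a <= t1 <= b -> a <= t2 <= b ->
      `|D2 W t1 - D2 W t2| <= C * `|t1 - t2| `^ theta).

(* Main.v *)
Require Import Defs.
From HB Require Import structures.
From mathcomp Require Import all_boot all_order all_algebra.
From mathcomp Require Import all_classical all_reals all_analysis.
From mathcomp Require Import Rstruct Rstruct_topology.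
From mathcomp Require Import measurable_realfun ring lra.
Import Order.TTheory GRing.Theory Num.Theory.
Import numFieldNormedType.Exports.
Local Open Scope classical_set_scope.
Local Open Scope ring_scope.
Set Implicit Arguments. Unset Strict Implicit. Unset Printing Implicit Defensive.

(** All exponents are taken equal, alpha = beta = gamma = delta = 5, and
    p = 2s/(5-1) = s/2. Starting from an odd C^5 step [step 0], constant
    outside [-1,1], put
      u(x) = sum_k (1-q) q^k step 0 (x / L^k),  with q = L^(-p).
    Then |u^(j)(x)| <= C (1+|x|)^(-j-p), while u' and 1-u are bounded below by
    multiples of (1+|x|)^(-1-p) and (1+|x|)^(-p), and x^p (1-u) and
    x^(1+p) u' oscillate forever: for q small both cross the value q between
    L^n/2 and L^n, which yields the sequences with the same constant q.

    Write L_s u(x) as the integral over h > 0 of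
    (u(x+h) + u(x-h) - 2u(x)) h^(-1-2s), and split it at h = (1+|x|)/2. The near
    part gains a factor (1+|x|)^(-p), and the far part sees the whole mass of
    u'; so (L_s u)' is bounded above and, for large x, below by multiples of
    x^(-1-2s). As u is increasing, W' := L_s u o u^(-1) is well defined, and
    W'' = ((L_s u)' / u') o u^(-1) is comparable to x^(-3p), hence to
    (1-|t|)^3. The potential W is the primitive of W', extended by 0. *)

(** * Taylor estimates *)

(** With all four exponents equal to 5, both 2s/(gamma-1) and 2s/(delta-1) are p, and the exponent
    for u' is 1+p, so by oddness the six identities reduce to two, one for 1-u and one for u'. The
    obstacle is that both carry the same C1: an exact tail 1-u = A x^(-p) has u' = pA x^(-1-p) with
    p < 1/2, and the constants differ. The tail must therefore oscillate on the logarithmic scale,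
    widely enough for both rescaled quantities to take a common value, while all two-sided bounds
    keep the exact power; a lacunary superposition of steps does this. Smoothness is counted
    backwards from W'': its Hölder continuity uses (L_s u)'', whose bounds involve four derivatives
    of u, and termwise differentiation of the series costs a fifth one on the step. *)

(** A quadratic remainder is a form of differentiability that survives averaging with uniform
    constants and gluing of pieces. It serves for the series, for the truncated polynomials and for
    W' at the wells. *)
Lemma quadratic_is_derive (R : realType) (f : R -> R) (x d M : R) :
  (forall h, `|h| <= 1 -> `|f (x + h) - f x - h * d| <= M * h ^+ 2) ->
  is_derive x 1 f d.
Proof.
move=> H.
have M0 : 0 <= M.
  have := H 1; rewrite normr1 lexx expr1n mulr1 => /(_ isT).
  exact: le_trans.
have cv : h^-1 *: (f (h + x) - f x) @[h --> 0^'] --> d.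
  apply/cvgrPdist_le => e e0; near=> h.
  have h0 : h != 0 by near: h; exact: nbhs_dnbhs_neq.
  have h1 : `|h| <= 1.
    near: h; apply: dnbhs0_le; exact: ltr01.
  have he : `|h| <= e / (M + 1).
    near: h; apply: dnbhs0_le; rewrite divr_gt0// ltr_wpDl//.
  rewrite distrC /GRing.scale/= [_ - d]addrC.
  have -> : - d + h^-1 * (f (h + x) - f x) = h^-1 * (f (x + h) - f x - h * d).
    by rewrite (addrC h x); field.
  rewrite normrM normfV ler_pdivrMl ?normr_gt0//.
  apply: (le_trans (H _ h1)).
  rewrite -real_normK ?num_real// expr2 mulrCA ler_pM2l ?normr_gt0//.
  apply: (@le_trans _ _ (M * (e / (M + 1)))); first exact: ler_wpM2l.
  rewrite mulrA ler_pdivrMr ?ltr_wpDl// mulrC ler_pM2l// lerDl ler01//.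
have dv : derivable f x 1.
  apply/cvg_ex; exists d.
  by under eq_fun do rewrite scaler1.
apply: DeriveDef => //.
rewrite -derive1E; apply/cvg_lim => //.
Unshelve. all: by end_near. Qed.

Definition has_derivative (R : realType) (f df : R -> R) : Prop :=
  forall x : R, is_derive x 1 f (df x).

Lemma has_derivative_continuous (R : realType) (f df : R -> R) :
  has_derivative f df -> continuous f.
Proof.
move=> H x; apply: differentiable_continuous; apply/derivable1_diffP.
by have [] := H x.
Qed.

Lemma mean_value (R : realType) (f df : R -> R) (a b : R) :
  has_derivative f df -> a < b ->
  exists c, [/\ a < c, c < b & f b - f a = df c * (b - a)].
Proof.
move=> H ab.
have [c] : exists2 c, c \in `]a, b[ & f b - f a = df c * (b - a).
  apply: MVT => //; apply: continuous_subspaceT.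
  exact: has_derivative_continuous H.
by rewrite in_itv/= => /andP[ac cb] E; exists c.
Qed.

Lemma mean_value_bound (R : realType) (f df : R -> R) (x y M : R) :
  has_derivative f df ->
  (forall z, `|z - x| <= `|y - x| -> `|df z| <= M) ->
  `|f y - f x| <= M * `|y - x|.
Proof.
move=> H B.
have cf := has_derivative_continuous H.
have aux a b : a <= b -> exists2 c, c \in `[a, b] & f b - f a = df c * (b - a).
  move=> ab; apply: MVT_segment => //.
  exact: continuous_subspaceT.
have [xy|yx] := leP x y.
  have [c] := aux _ _ xy; rewrite in_itv/= => /andP[c1 c2] ->.
  rewrite normrM ler_wpM2r//; apply: B.
  by rewrite !ger0_norm ?subr_ge0// lerB.
have [c] := aux _ _ (ltW yx); rewrite in_itv/= => /andP[c1 c2] E.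
rewrite distrC E normrM (distrC x y) ler_wpM2r//; apply: B.
by rewrite !ler0_norm ?subr_le0 ?(ltW yx)// !opprB lerB.
Qed.

(** The mean value inequality is applied to [f y - y * f1 x] and then to [f1]; the constant M
    instead of M/2 is the price of avoiding an integral remainder. *)
Lemma taylor_bound (R : realType) (f f1 f2 : R -> R) (x h M : R) :
  has_derivative f f1 -> has_derivative f1 f2 ->
  (forall z, `|z - x| <= `|h| -> `|f2 z| <= M) ->
  `|f (x + h) - f x - h * f1 x| <= M * h ^+ 2.
Proof.
move=> H1 H2 B.
pose g y := f y - y * f1 x.
have Hg : has_derivative g (fun y => f1 y - f1 x).
  move=> y.
  have Hy := H1 y; apply: is_derive_eq.
  by rewrite scaler0 add0r /GRing.scale/= mulr1.
have M0 : 0 <= M by apply: le_trans (B x _) => //; rewrite subrr normr0.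
have -> : f (x + h) - f x - h * f1 x = g (x + h) - g x by rewrite /g; ring.
have xh : `|x + h - x| = `|h| by congr (`|_|); ring.
rewrite -real_normK ?num_real// expr2 mulrA -[in X in _ <= _ * X]xh.
apply: (mean_value_bound Hg) => z; rewrite xh => zh.
apply: (le_trans (mean_value_bound H2 _)); last exact: ler_wpM2l zh.
by move=> w wz; apply: B; exact: le_trans zh.
Qed.

Definition diff2 (R : realType) (f : R -> R) (x h : R) : R :=
  f (x + h) + f (x - h) - 2 * f x.

(** The first-order terms at h and -h cancel, leaving two Taylor remainders. *)
Lemma diff2_quadratic (R : realType) (f f1 f2 : R -> R) (x h M : R) :
  has_derivative f f1 -> has_derivative f1 f2 ->
  (forall z, `|z - x| <= `|h| -> `|f2 z| <= M) ->
  `|diff2 f x h| <= 2 * M * h ^+ 2.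
Proof.
move=> H1 H2 B.
have -> : diff2 f x h = (f (x + h) - f x - h * f1 x) +
   (f (x + - h) - f x - (- h) * f1 x) by rewrite /diff2; ring.
apply: (le_trans (ler_normD _ _)).
have := taylor_bound H1 H2 B.
have : `|f (x + - h) - f x - (- h) * f1 x| <= M * (- h) ^+ 2.
  by apply: taylor_bound H1 H2 _ => z; rewrite normrN; exact: B.
rewrite sqrrN; lra.
Qed.

Lemma diff2_bounded (R : realType) (f : R -> R) (x h M : R) :
  (forall x, `|f x| <= M) -> `|diff2 f x h| <= 4 * M.
Proof.
move=> B; rewrite /diff2.
apply: (le_trans (ler_normB _ _)).
rewrite normrM (ger0_norm (ler0n _ _)).
have := ler_normD (f (x + h)) (f (x - h)).
have := B (x + h); have := B (x - h); have := B x; lra.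
Qed.

Lemma has_derivative_affine (R : realType) (f df : R -> R) (a b : R) :
  has_derivative f df -> has_derivative (fun y => f (a * y + b)) (fun y => a * df (a * y + b)).
Proof.
move=> H y; have Hy := H (a * y + b).
have L : is_derive y 1 (fun y : R => a * y + b) a.
  by apply: is_derive_eq; rewrite /GRing.scale/=; ring.
have := @is_derive1_comp R f (fun y : R => a * y + b) y _ _ Hy L.
by rewrite mulrC.
Qed.

(** * The kernel of the fractional Laplacian *)

Lemma le0_powR_nincr (R : realType) (a x y : R) :
  a <= 0 -> 0 < x -> x <= y -> y `^ a <= x `^ a.
Proof.
move=> a0 x0 xy.
have y0 : 0 < y := lt_le_trans x0 xy.
rewrite -[a]opprK !(powRN _ (- a)) lef_pV2 ?posrE ?powR_gt0//.
by apply: ge0_ler_powR; rewrite ?nnegrE ?oppr_ge0// ltW.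
Qed.

Lemma lt0_powR_cvgy (R : realType) (a : R) : a < 0 ->
  x `^ a @[x --> +oo] --> (0 : R).
Proof.
move=> a0; apply/cvgrPdist_le => e e0; near=> x.
rewrite sub0r normrN ger0_norm ?powR_ge0//.
have -> : e = (e `^ a^-1) `^ a by rewrite -powRrM mulVf ?lt_eqF// powRr1// ltW.
apply: le0_powR_nincr; [exact: ltW|exact: powR_gt0|].
near: x; apply: nbhs_pinfty_ge; exact: num_real.
Unshelve. all: by end_near. Qed.

Lemma powR_continuous_at (R : realType) (a x : R) : 0 < x ->
  {for x, continuous (fun y : R => y `^ a)}.
Proof.
move=> x0; apply: differentiable_continuous; apply/derivable1_diffP.
by have [] := is_derive1_powR a x0.
Qed.

Section kernel.
Context {R : realType}.
Notation mu := (@lebesgue_measure R).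
Implicit Types s r h : R.

Definition frac_kernel s h : R := h `^ (-1 - 2 * s).

Lemma frac_kernel_ge0 s h : 0 <= frac_kernel s h.
Proof. exact: powR_ge0. Qed.

Lemma frac_kernel_nincr s h r : 0 < s -> 0 < h -> h <= r ->
  frac_kernel s r <= frac_kernel s h.
Proof. by move=> s0; apply: le0_powR_nincr; lra. Qed.

Lemma measurable_frac_kernel s (D : set R) : measurable_fun D (frac_kernel s).
Proof. by apply: measurable_funTS; exact: measurable_powR. Qed.

Lemma frac_kernel_sqr s h : 0 < h -> h ^+ 2 * frac_kernel s h = h `^ (1 - 2 * s).
Proof.
move=> h0; rewrite -powR_mulrn ?ltW// -powRD; first by congr (_ `^ _); ring.
by apply/implyP => _; rewrite gt_eqF.
Qed.

Lemma integral_frac_kernel_infty s r : 0 < s -> 0 < r ->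
  (\int[mu]_(h in `[r, +oo[) (frac_kernel s h)%:E = (r `^ (- (2 * s)) / (2 * s))%:E)%E.
Proof.
move=> s0 r0.
pose F h := - (2 * s)^-1 * h `^ (- (2 * s)).
have dF h : 0 < h -> is_derive h 1 F (frac_kernel s h).
  move=> h0; have H := is_derive1_powR (- (2 * s)) h0.
  apply: is_derive_eq.
  rewrite /frac_kernel /GRing.scale/= (_ : - (2 * s) - 1 = -1 - 2 * s); last ring.
  by field; lra.
rewrite (@ge0_continuous_FTC2y _ _ F r 0).
- by rewrite /F -EFinB; congr (_%:E); field; lra.
- by move=> h rh; exact: frac_kernel_ge0.
- apply: continuous_in_subspaceT => h /[!inE]/=; rewrite in_itv/= andbT => rh.
  by apply: powR_continuous_at; exact: lt_le_trans rh.
- rewrite -[0](mulr0 (- (2 * s)^-1)); apply: cvgMr; apply: lt0_powR_cvgy; lra.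
- by move=> h rh; have [] := dF h (lt_trans r0 rh).
- apply: cvg_at_right_filter; apply: differentiable_continuous.
  by apply/derivable1_diffP; have [] := dF r r0.
- move=> h; rewrite in_itv/= andbT => rh.
  by rewrite derive1E; have [_ ->] := dF h (lt_trans r0 rh).
Qed.

Lemma integrable_frac_kernel s r : 0 < s -> 0 < r ->
  mu.-integrable `[r, +oo[ (EFin \o frac_kernel s).
Proof.
move=> s0 r0; apply/integrableP; split.
  by apply/measurable_EFinP; exact: measurable_frac_kernel.
under eq_integral => h _ do rewrite /= ger0_norm ?frac_kernel_ge0//.
by rewrite integral_frac_kernel_infty// ltry.
Qed.

(** For s > 1/2 the integrand h^(1-2s) blows up at 0, so the primitive is evaluated on [1/(n+1), r]
    and monotone convergence concludes. Dropping the nonnegative value of the primitive at the lower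
    end makes each integral at most the claimed bound. *)
Lemma integral_frac_kernel_zero s r : 0 < s < 1 -> 0 < r ->
  (\int[mu]_(h in `]0%R, r]) (h ^+ 2 * frac_kernel s h)%:E <=
    (r `^ (2 - 2 * s) / (2 - 2 * s))%:E)%E.
Proof.
move=> /andP[s0 s1] r0.
pose F h := (2 - 2 * s)^-1 * h `^ (2 - 2 * s).
have dF h : 0 < h -> is_derive h 1 F (h ^+ 2 * frac_kernel s h).
  move=> h0; have H := is_derive1_powR (2 - 2 * s) h0.
  apply: is_derive_eq.
  rewrite frac_kernel_sqr// /GRing.scale/= (_ : 2 - 2 * s - 1 = 1 - 2 * s); last ring.
  by field; lra.
have F0 h : 0 <= F h by rewrite mulr_ge0 ?powR_ge0// invr_ge0; lra.
have mg (D : set R) : measurable_fun D (fun h => (h ^+ 2 * frac_kernel s h)%:E).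
  apply/measurable_EFinP; apply: measurable_funM; last exact: measurable_frac_kernel.
  by apply: measurable_funTS; exact: exprn_measurable.
have g0 h : 0 <= h ^+ 2 * frac_kernel s h.
  by rewrite mulr_ge0 ?sqr_ge0 ?frac_kernel_ge0.
rewrite itv_open_bnd_bigcup.
set A : (set R)^nat := fun n : nat => [set` `[0 + n.+1%:R^-1, r]%R].
have ndA : nondecreasing_seq A.
  move=> m n mn; apply/subsetPset; apply: subset_itvr => /=.
  by rewrite bnd_simp !add0r lef_pV2 ?posrE// ler_nat.
have mA i : measurable (A i) by exact: measurable_itv.
have cv : (\int[mu]_(h in A i) (h ^+ 2 * frac_kernel s h)%:E @[i --> \oo] -->
    \int[mu]_(h in \bigcup_i A i) (h ^+ 2 * frac_kernel s h)%:E)%E.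
  apply: ge0_nondecreasing_set_cvg_integral; [exact: ndA|exact: mA| |].
 - by move=> i; exact: mg.
 - by move=> i h _; rewrite lee_fin; exact: g0.
apply: (cvge_to_le cv); apply: nearW => n.
rewrite /A add0r; set a := n.+1%:R^-1.
have a0 : 0 < a by rewrite invr_gt0.
have [ra|ar] := leP r a.
  apply: (@le_trans _ _ 0%E); last by rewrite lee_fin mulrC F0.
  move: ra; rewrite le_eqVlt => /predU1P[->|ra].
    by rewrite set_itv1 integral_set1.
  by rewrite set_itv_ge ?integral_set0// bnd_simp -ltNge.
have dFa h : a <= h -> derivable F h 1.
  by move=> ah; have [] := dF h (lt_le_trans a0 ah).
have cF h : a <= h -> {for h, continuous F}.
  by move=> ah; apply: differentiable_continuous; apply/derivable1_diffP; exact: dFa.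
rewrite (@continuous_FTC2 _ _ F)//.
- by rewrite -EFinB lee_fin /F; have := F0 a; rewrite /F; lra.
- apply: continuous_in_subspaceT => h /[!inE]/=; rewrite in_itv/= => /andP[ah _].
  have h0 := lt_le_trans a0 ah.
  apply: cvgM; last exact: powR_continuous_at.
  exact: exprn_continuous.
- split.
  + by move=> h; rewrite in_itv/= => /andP[/ltW ah _]; exact: dFa.
  + by apply: cvg_at_right_filter; exact: cF.
  + by apply: cvg_at_left_filter; apply: cF; exact: ltW.
- move=> h; rewrite in_itv/= => /andP[ah _].
  by rewrite derive1E; have [_ ->] := dF h (lt_trans a0 ah).
Qed.

Lemma integrable_frac_kernel_zero s r : 0 < s < 1 -> 0 < r ->
  mu.-integrable `]0, r] (EFin \o (fun h : R => h ^+ 2 * frac_kernel s h)).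
Proof.
move=> s01 r0; apply/integrableP; split.
  apply/measurable_EFinP; apply: measurable_funM; last exact: measurable_frac_kernel.
  by apply: measurable_funTS; exact: exprn_measurable.
have -> : (\int[mu]_(h in `]0%R, r]) `|(h ^+ 2 * frac_kernel s h)%:E| =
    \int[mu]_(h in `]0%R, r]) (h ^+ 2 * frac_kernel s h)%:E)%E.
  apply: eq_integral => h _ /=.
  by rewrite ger0_norm// mulr_ge0 ?sqr_ge0 ?frac_kernel_ge0.
by apply: le_lt_trans (integral_frac_kernel_zero s01 r0) _; rewrite ltry.
Qed.
End kernel.

(** * The fractional Laplacian as an integral of second differences *)

Section fractional_laplacian.
Context {R : realType}.
Notation mu := (@lebesgue_measure R).
Implicit Types (s r x h : R) (f : R -> R).

Lemma integrable_setU (A B : set R) f : measurable A -> measurable B ->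
  [disjoint A & B] ->
  mu.-integrable A (EFin \o f) -> mu.-integrable B (EFin \o f) ->
  mu.-integrable (A `|` B) (EFin \o f).
Proof.
move=> mA mB AB /integrableP[mfA iA] /integrableP[mfB iB].
have mf : measurable_fun (A `|` B) (EFin \o f) by apply/measurable_funU.
apply/integrableP; split => //.
rewrite ge0_integral_setU//=; first exact: lte_add_pinfty.
by apply/measurable_EFinP; apply: measurableT_comp => //; exact/measurable_EFinP.
Qed.

Lemma itv0y_split r : 0 < r ->
  `]0, +oo[%classic = `]0, r]%classic `|` `]r, +oo[%classic :> set R.
Proof.
by move=> r0; rewrite -(@itv_bndbnd_setU _ _ (BRight 0) (BRight r)) ?bnd_simp ?ltW.
Qed.

Lemma disjoint_itv0y r : [disjoint `]0, r]%classic & `]r, +oo[%classic : set R].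
Proof.
apply/disj_setPS => y [/=]; rewrite !in_itv/= => /andP[_ yr] /andP[ry _].
by move: ry; rewrite ltNge yr.
Qed.

Lemma integrable_scale (D : set R) f c : measurable D ->
  mu.-integrable D (EFin \o f) -> mu.-integrable D (EFin \o (fun h => c * f h)).
Proof.
move=> mD i; have := @integrableZl _ _ _ mu D mD c _ i.
by apply: eq_integrable => // h _ /=; rewrite EFinM.
Qed.

Lemma measurable_diff2_kernel s f x (D : set R) : continuous f ->
  measurable_fun D (fun h => diff2 f x h * frac_kernel s h).
Proof.
move=> cf; apply: measurable_funM; last exact: measurable_frac_kernel.
apply: measurable_funTS; apply: continuous_measurable_fun => h.
apply: cvgB; last exact: cvg_cst.
apply: cvgD.
  apply: (continuous_comp (f := fun h => x + h)); last exact: cf.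
  by apply: cvgD; [exact: cvg_cst|exact: cvg_id].
apply: (continuous_comp (f := fun h => x - h)); last exact: cf.
by apply: cvgB; [exact: cvg_cst|exact: cvg_id].
Qed.

Lemma near_integrable s f x A r : 0 < s < 1 -> 0 < r -> continuous f ->
  (forall h, 0 < h <= r -> `|diff2 f x h| <= A * h ^+ 2) ->
  mu.-integrable `]0, r] (EFin \o (fun h => diff2 f x h * frac_kernel s h)).
Proof.
move=> s01 r0 cf B.
have ig : mu.-integrable `]0, r] (EFin \o (fun h => A * (h ^+ 2 * frac_kernel s h))).
  by apply: integrable_scale => //; exact: integrable_frac_kernel_zero.
apply: le_integrable ig => //.
  by apply/measurable_EFinP; exact: measurable_diff2_kernel.
move=> h /=; rewrite in_itv/= => hr.
rewrite lee_fin mulrA !(normrM _ (frac_kernel _ _)) ler_wpM2r//.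
by apply: le_trans (ler_norm _); exact: B.
Qed.

Lemma far_integrable s f x B r : 0 < s -> 0 < r -> continuous f ->
  (forall h, r < h -> `|diff2 f x h| <= B) ->
  mu.-integrable `]r, +oo[ (EFin \o (fun h => diff2 f x h * frac_kernel s h)).
Proof.
move=> s0 r0 cf H.
have ig : mu.-integrable `]r, +oo[ (EFin \o (fun h => B * frac_kernel s h)).
  apply: integrable_scale => //; apply: integrableS (integrable_frac_kernel s0 r0) => //.
  by apply: subset_itvr; rewrite bnd_simp.
apply: le_integrable ig => //.
  by apply/measurable_EFinP; exact: measurable_diff2_kernel.
move=> h /=; rewrite in_itv/= andbT => hr.
rewrite lee_fin !(normrM _ (frac_kernel _ _)) ler_wpM2r//.
by apply: le_trans (ler_norm _); exact: H.
Qed.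

Lemma diff2_integrable s f x A B r : 0 < s < 1 -> 0 < r -> continuous f ->
  (forall h, 0 < h <= r -> `|diff2 f x h| <= A * h ^+ 2) ->
  (forall h, r < h -> `|diff2 f x h| <= B) ->
  mu.-integrable `]0, +oo[ (EFin \o (fun h => diff2 f x h * frac_kernel s h)).
Proof.
move=> s01 r0 cf HA HB; have /andP[s0 _] := s01.
rewrite (itv0y_split r0); apply: integrable_setU => //.
- exact: disjoint_itv0y.
- exact: near_integrable HA.
- exact: far_integrable HB.
Qed.

(* Second differences are quadratic in [h], so the singularity at [h = 0] is integrable and no
   principal value is needed. *)
Definition frac_lap s f x : R :=
  \int[mu]_(h in `]0, +oo[) (diff2 f x h * frac_kernel s h).

Lemma frac_lap_split s f x A B r : 0 < s < 1 -> 0 < r -> continuous f ->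
  (forall h, 0 < h <= r -> `|diff2 f x h| <= A * h ^+ 2) ->
  (forall h, r < h -> `|diff2 f x h| <= B) ->
  frac_lap s f x = \int[mu]_(h in `]0, r]) (diff2 f x h * frac_kernel s h) +
    \int[mu]_(h in `]r, +oo[) (diff2 f x h * frac_kernel s h).
Proof.
move=> s01 r0 cf HA HB.
rewrite /frac_lap (itv0y_split r0) Rintegral_setU//.
- by rewrite -(itv0y_split r0); exact: diff2_integrable HA HB.
- exact: disjoint_itv0y.
Qed.

Lemma near_bound s f x A r : 0 < s < 1 -> 0 < r -> continuous f ->
  (forall h, 0 < h <= r -> `|diff2 f x h| <= A * h ^+ 2) ->
  `|\int[mu]_(h in `]0, r]) (diff2 f x h * frac_kernel s h)| <=
    A * (r `^ (2 - 2 * s) / (2 - 2 * s)).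
Proof.
move=> s01 r0 cf HA.
have A0 : 0 <= A.
  have := HA r; rewrite r0 lexx => /(_ isT) /(le_trans (normr_ge0 _)).
  by rewrite pmulr_lge0// exprn_gt0.
have i1 := near_integrable s01 r0 cf HA.
have i2 := integrable_frac_kernel_zero s01 r0.
apply: (le_trans (le_normr_Rintegral _ i1)) => //.
apply: (@le_trans _ _ (\int[mu]_(h in `]0, r]) (A * (h ^+ 2 * frac_kernel s h)))).
  apply: le_Rintegral => //.
  - have := integrable_norm i1.
    by apply: eq_integrable.
  - exact: integrable_scale.
  - move=> h; rewrite /= in_itv/= => hr.
    by rewrite normrM (ger0_norm (frac_kernel_ge0 _ _)) mulrA ler_wpM2r ?frac_kernel_ge0 ?HA.
rewrite RintegralZl//; apply: ler_wpM2l => //.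
rewrite -lee_fin; apply: le_trans (integral_frac_kernel_zero s01 r0).
rewrite /Rintegral fineK//; exact: integrable_fin_num i2.
Qed.

Lemma Rintegral_frac_kernel_infty s r : 0 < s -> 0 < r ->
  \int[mu]_(h in `]r, +oo[) frac_kernel s h = r `^ (- (2 * s)) / (2 * s).
Proof.
move=> s0 r0; rewrite Rintegral_itv_obnd_cbnd.
  by rewrite /Rintegral integral_frac_kernel_infty.
apply: integrableS (integrable_frac_kernel s0 r0) => //.
by apply: subset_itvr; rewrite bnd_simp.
Qed.

Lemma far_bound s f x B r : 0 < s -> 0 < r -> continuous f ->
  (forall h, r < h -> `|diff2 f x h| <= B) ->
  `|\int[mu]_(h in `]r, +oo[) (diff2 f x h * frac_kernel s h)| <=
    B * (r `^ (- (2 * s)) / (2 * s)).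
Proof.
move=> s0 r0 cf H.
have i1 := far_integrable s0 r0 cf H.
have i2 : mu.-integrable `]r, +oo[ (EFin \o frac_kernel s).
  apply: integrableS (integrable_frac_kernel s0 r0) => //.
  by apply: subset_itvr; rewrite bnd_simp.
apply: (le_trans (le_normr_Rintegral _ i1)) => //.
rewrite -Rintegral_frac_kernel_infty// -RintegralZl//.
apply: le_Rintegral => //.
- by have := integrable_norm i1; apply: eq_integrable.
- exact: integrable_scale.
- move=> h; rewrite /= in_itv/= andbT => hr.
  by rewrite normrM (ger0_norm (frac_kernel_ge0 _ _)) ler_wpM2r ?frac_kernel_ge0 ?H.
Qed.

(** Differentiation under the integral sign. Second differences of [f1] are at most 2M h^2 for h <=
    1 and 4M beyond, uniformly in the base point, and this majorant is integrable against the
    kernel. *)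
Lemma frac_lap_derivative s f f1 f2 f3 (M : R) : 0 < s < 1 ->
  has_derivative f f1 -> has_derivative f1 f2 -> has_derivative f2 f3 ->
  (forall x, `|f x| <= M) -> (forall x, `|f1 x| <= M) ->
  (forall x, `|f2 x| <= M) -> (forall x, `|f3 x| <= M) ->
  has_derivative (frac_lap s f) (frac_lap s f1).
Proof.
move=> s01 d0 d1 d2 b0 b1 b2 b3 x; have /andP[s0 _] := s01.
have M0 : 0 <= M := le_trans (normr_ge0 _) (b0 0).
have d2a z h : `|diff2 f z h| <= 2 * M * h ^+ 2 by apply: diff2_quadratic d0 d1 _.
have d2b z h : `|diff2 f1 z h| <= 2 * M * h ^+ 2 by apply: diff2_quadratic d1 d2 _.
have d2c z h : `|diff2 f z h| <= 4 * M by exact: diff2_bounded.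
have d2d z h : `|diff2 f1 z h| <= 4 * M by exact: diff2_bounded.
pose F z h := diff2 f z h * frac_kernel s h.
have iF z : mu.-integrable `]0, +oo[ (EFin \o F z).
  apply: (@diff2_integrable _ _ _ (2 * M) (4 * M) 1) => //.
  exact: has_derivative_continuous d0.
have dF (z h : R) : is_derive z 1 (F ^~ h) (diff2 f1 z h * frac_kernel s h).
  have H1 := d0 (z + h); have H2 := d0 (z - h); have H3 := d0 z.
  have G1 : is_derive z 1 (fun y => f (y + h)) (f1 (z + h)).
    have := has_derivative_affine 1 h d0 z.
    by rewrite !mul1r; under eq_fun do rewrite mul1r.
  have G2 : is_derive z 1 (fun y => f (y - h)) (f1 (z - h)).
    have := has_derivative_affine 1 (- h) d0 z.
    by rewrite !mul1r; under eq_fun do rewrite mul1r.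
  rewrite /F /diff2; apply: is_derive_eq.
  rewrite /GRing.scale/=; ring.
pose G h := (if h <= 1 then 2 * M * h ^+ 2 else 4 * M) * frac_kernel s h.
have G0 h : 0 <= G h.
  apply: mulr_ge0; last exact: frac_kernel_ge0.
  by case: ifP => _; [apply: mulr_ge0; [lra|exact: sqr_ge0]|lra].
have iG : mu.-integrable `]0, +oo[ (EFin \o G).
  rewrite (itv0y_split ltr01); apply: integrable_setU => //.
  - exact: disjoint_itv0y.
  - have : mu.-integrable `]0, 1] (EFin \o (fun h => (2 * M) * (h ^+ 2 * frac_kernel s h))).
      by apply: integrable_scale => //; exact: integrable_frac_kernel_zero.
    apply: eq_integrable => // h; rewrite inE/= in_itv/= => /andP[_ h1].
    by rewrite /G /= h1 mulrA.
  - have : mu.-integrable `]1, +oo[ (EFin \o frac_kernel s).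
      apply: integrableS (integrable_frac_kernel s0 ltr01) => //.
      by apply: subset_itvr; rewrite bnd_simp.
    move=> /(integrable_scale (4 * M)) /=.
    move=> /(_ (measurable_itv _)).
    apply: eq_integrable => // h; rewrite inE/= in_itv/= andbT => h1.
    by rewrite /G /= leNgt h1.
have bG z h : `](x - 1), (x + 1)[%classic z -> `]0, +oo[%classic h -> `|partial1of2 F z h| <= G h.
  move=> _ _; rewrite partial1of2E; have [_ ->] := dF z h.
  rewrite /G normrM (ger0_norm (frac_kernel_ge0 _ _)) ler_wpM2r ?frac_kernel_ge0//.
  by case: ifP.
have xI : `](x - 1), (x + 1)[%classic x by rewrite /= in_itv/=; apply/andP; split; lra.
have iF' z : `](x - 1), (x + 1)[%classic z -> mu.-integrable `]0, +oo[ (EFin \o F z).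
  by move=> _; exact: iF.
have dF' z h : `](x - 1), (x + 1)[%classic z -> `]0, +oo[%classic h ->
    derivable (F ^~ h) z 1.
  by move=> _ _; have [] := dF z h.
have m0 : measurable (`]0, +oo[%classic : set (measurableTypeR R)) by exact: measurable_itv.
have -> : frac_lap s f = (fun z => \int[mu]_(h in `]0, +oo[) F z h) by [].
have H1 := @derivable_under_integral R _ _ mu F _ m0 x (x - 1) (x + 1) xI iF' dF' G G0 iG bG.
have H2 := @differentiation_under_integral R _ _ mu F _ m0 x (x - 1) (x + 1) xI iF' dF' G G0 iG bG.
apply: DeriveDef; first exact: H1.
rewrite -derive1E H2.
by apply: eq_Rintegral => h _; rewrite partial1of2E; have [_ ->] := dF x h.
Qed.

End fractional_laplacian.

(** * Principal values *)

Section principal_value.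
Context {R : realType}.
Notation mu := (@lebesgue_measure R).
Implicit Types (s r x h e : R) (f g u : R -> R).

Lemma frac_kernel_continuous s h : 0 < h -> {for h, continuous (frac_kernel s)}.
Proof. exact: powR_continuous_at. Qed.

Lemma frac_kernel_dist_continuous s x y : y != x ->
  {for y, continuous (fun y => frac_kernel s `|x - y|)}.
Proof.
move=> yx; apply: (continuous_comp (f := fun y => `|x - y|)).
  apply: (continuous_comp (f := fun y => x - y)); last exact: norm_continuous.
  by apply: cvgB; [exact: cvg_cst|exact: cvg_id].
by apply: frac_kernel_continuous; rewrite normr_gt0 subr_eq0 eq_sym.
Qed.

(** The change of variables y = x + h on a half-line is used in its version for nonnegative
    integrands; hence the sign condition on [g], which monotonicity of u will supply. *)
Lemma integral_right_half s x e g : 0 < s -> 0 < e -> continuous g ->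
  (forall y, x <= y -> 0 <= g y) ->
  (\int[mu]_(y in `[(x + e)%R, +oo[) (g y * frac_kernel s `|x - y|)%:E =
   \int[mu]_(h in `[e, +oo[) (g (x + h) * frac_kernel s h)%:E)%E.
Proof.
move=> s0 e0 cg g0.
have dF (h : R) : is_derive h 1 (fun h : R => x + h) 1.
  by have := is_deriveD (is_derive_cst x h 1) (is_derive_id h 1); rewrite add0r.
have dFE : derive1 (fun h : R => x + h) = cst (1 : R).
  by apply/funext => h; rewrite derive1E; have [_ ->] := dF h.
have := @increasing_ge0_integration_by_substitutiony R (fun h : R => x + h)
  (fun y => g y * frac_kernel s `|x - y|) e.
rewrite dFE => ->.
- apply: eq_integral => h; rewrite inE/= in_itv/= andbT => eh.
  have xh : `|x - (x + h)| = h.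
    by rewrite opprD addrA subrr add0r normrN gtr0_norm//; exact: lt_le_trans eh.
  by rewrite -[in RHS](mulr1 (_ * _)) -[h in frac_kernel s h]xh.
- by move=> a b _ _ ab; rewrite ltrD2l.
- by move=> h _; exact: cst_continuous.
- exact: is_cvg_cst.
- exact: is_cvg_cst.
- split; first by move=> h _; have [] := dF h.
  by apply: cvg_at_right_filter; apply: cvgD; [exact: cvg_cst|exact: cvg_id].
- apply/cvgryPge => A; near=> h; rewrite -lerBlDl.
  by near: h; apply: nbhs_pinfty_ge; exact: num_real.
- apply: continuous_in_subspaceT => y /[!inE]/=; rewrite in_itv/= andbT => xy.
  apply: cvgM; first exact: cg.
  by apply: frac_kernel_dist_continuous; rewrite gt_eqF//; lra.
- move=> y; rewrite in_itv/= andbT => xy.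
  by rewrite mulr_ge0 ?frac_kernel_ge0// g0//; lra.
Unshelve. all: by end_near. Qed.

Lemma integral_left_half s x e g : 0 < s -> 0 < e -> continuous g ->
  (forall y, y <= x -> 0 <= g y) ->
  (\int[mu]_(y in `]-oo, (x - e)%R]) (g y * frac_kernel s `|x - y|)%:E =
   \int[mu]_(h in `[e, +oo[) (g (x - h) * frac_kernel s h)%:E)%E.
Proof.
move=> s0 e0 cg g0.
have dF (h : R) : is_derive h 1 (fun h : R => x - h) (-1).
  by have := is_deriveB (is_derive_cst x h 1) (is_derive_id h 1); rewrite sub0r.
have dFE : derive1 (fun h : R => x - h) = cst (-1 : R).
  by apply/funext => h; rewrite derive1E; have [_ ->] := dF h.
have := @decreasing_ge0_integration_by_substitutiony R (fun h : R => x - h)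
  (fun y => g y * frac_kernel s `|x - y|) e.
rewrite dFE => ->.
- apply: eq_integral => h; rewrite inE/= in_itv/= andbT => eh.
  have xh : `|x - (x - h)| = h.
    by rewrite opprB addrCA subrr addr0 gtr0_norm//; exact: lt_le_trans eh.
  rewrite -[in RHS](mulr1 (_ * _)) -[h in frac_kernel s h]xh; congr (_ * _)%:E.
  exact: opprK.
- by move=> a b _ _ ab; rewrite ltrD2l ltrN2.
- by move=> h _; exact: cst_continuous.
- exact: is_cvg_cst.
- exact: is_cvg_cst.
- split; first by move=> h _; have [] := dF h.
  by apply: cvg_at_right_filter; apply: cvgB; [exact: cvg_cst|exact: cvg_id].
- apply/cvgrNyPle => A; near=> h; rewrite lerBlDr -lerBlDl.
  by near: h; apply: nbhs_pinfty_ge; exact: num_real.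
- apply: continuous_in_subspaceT => y /[!inE]/=; rewrite in_itv/= => xy.
  apply: cvgM; first exact: cg.
  by apply: frac_kernel_dist_continuous; rewrite lt_eqF//; lra.
- move=> y; rewrite in_itv/= => xy.
  by rewrite mulr_ge0 ?frac_kernel_ge0// g0//; lra.
Unshelve. all: by end_near. Qed.

Lemma measurable_frac_kernel_dist s x (D : set R) :
  measurable_fun D (fun y => frac_kernel s `|x - y|).
Proof.
apply: measurable_funTS.
apply: measurableT_comp; first exact: measurable_powR.
apply: measurableT_comp => //.
exact: measurable_funB.
Qed.

Lemma bounded_kernel_integrable s e f (B : R) : 0 < s -> 0 < e -> continuous f ->
  (forall h, `|f h| <= B) ->
  mu.-integrable `[e, +oo[ (EFin \o (fun h => f h * frac_kernel s h)).
Proof.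
move=> s0 e0 cf fB.
have ig : mu.-integrable `[e, +oo[ (EFin \o (fun h => B * frac_kernel s h)).
  by apply: integrable_scale => //; exact: integrable_frac_kernel.
apply: le_integrable ig => //.
  apply/measurable_EFinP; apply: measurable_funM; last exact: measurable_frac_kernel.
  by apply: measurable_funTS; exact: continuous_measurable_fun.
move=> h _ /=; rewrite lee_fin !(normrM _ (frac_kernel _ _)) ler_wpM2r//.
exact: le_trans (ler_norm _).
Qed.

Lemma ge0_integrable_of_integral (D : set R) f (l : R) : measurable D ->
  measurable_fun D f -> (forall y, D y -> 0 <= f y) ->
  (\int[mu]_(y in D) (f y)%:E = l%:E)%E -> mu.-integrable D (EFin \o f).
Proof.
move=> mD mf f0 fl; apply/integrableP; split; first exact/measurable_EFinP.
have -> : (\int[mu]_(y in D) `|(EFin \o f) y| = \int[mu]_(y in D) (f y)%:E)%E.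
  by apply: eq_integral => y /[!inE] Dy /=; rewrite ger0_norm// f0.
by rewrite fl ltry.
Qed.

(** For monotone u the difference u(y) - u(x) has a constant sign on each side of x, so each half
    can be moved to h > e separately; subtracting the two halves produces the second difference. *)
Lemma integral_outside s x e u (B : R) : 0 < s -> 0 < e -> continuous u ->
  {homo u : a b / a <= b} -> (forall y, `|u y| <= B) ->
  mu.-integrable [set y | e < `|y - x|]
    (EFin \o (fun y => (u y - u x) * frac_kernel s `|x - y|)) /\
  (\int[mu]_(y in [set y | (e < `|y - x|)%R]) ((u y - u x) * frac_kernel s `|x - y|)%:E =
   (\int[mu]_(h in `]e, +oo[) (diff2 u x h * frac_kernel s h)%R)%:E)%E.
Proof.
move=> s0 e0 cu uh uB.
pose G y := (u y - u x) * frac_kernel s `|x - y|.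
have mG (D : set R) : measurable_fun D G.
  apply: measurable_funM; last exact: measurable_frac_kernel_dist.
  by apply: measurable_funB => //; apply: measurable_funTS; exact: continuous_measurable_fun.
have cR : continuous (fun h : R => u (x + h) - u x).
  move=> h; apply: cvgB; last exact: cvg_cst.
  apply: (continuous_comp (f := fun h => x + h)); last exact: cu.
  by apply: cvgD; [exact: cvg_cst|exact: cvg_id].
have cL : continuous (fun h : R => u x - u (x - h)).
  move=> h; apply: cvgB; first exact: cvg_cst.
  apply: (continuous_comp (f := fun h => x - h)); last exact: cu.
  by apply: cvgB; [exact: cvg_cst|exact: cvg_id].
have bR (h : R) : `|u (x + h) - u x| <= 2 * B.
  by apply: le_trans (ler_normB _ _) _; have := uB (x + h); have := uB x; lra.
have bL (h : R) : `|u x - u (x - h)| <= 2 * B.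
  by apply: le_trans (ler_normB _ _) _; have := uB (x - h); have := uB x; lra.
have iR := bounded_kernel_integrable s0 e0 cR bR.
have iL := bounded_kernel_integrable s0 e0 cL bL.
set IR := \int[mu]_(h in `[e, +oo[) ((u (x + h) - u x) * frac_kernel s h).
set IL := \int[mu]_(h in `[e, +oo[) ((u x - u (x - h)) * frac_kernel s h).
have eR : (\int[mu]_(y in `](x + e)%R, +oo[) (G y)%:E = IR%:E)%E.
  rewrite integral_itv_obnd_cbnd; last exact/measurable_EFinP.
  rewrite (integral_right_half (g := fun y => u y - u x))//.
  - by rewrite /IR /Rintegral fineK//; exact: integrable_fin_num iR.
  - by move=> y; apply: cvgB; [exact: cu|exact: cvg_cst].
  - by move=> y xy; rewrite subr_ge0 uh.
have eL : (\int[mu]_(y in `]-oo, (x - e)%R[) ((- G y)%R)%:E = IL%:E)%E.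
  rewrite integral_itv_bndo_bndc; last first.
    by apply/measurable_EFinP; exact: measurableT_comp.
  have -> : (fun y => (- G y)%:E) = (fun y => ((u x - u y) * frac_kernel s `|x - y|)%:E).
    by apply/funext => y; rewrite /G -mulNr opprB.
  rewrite (integral_left_half (g := fun y => u x - u y))//.
  - by rewrite /IL /Rintegral fineK//; exact: integrable_fin_num iL.
  - by move=> y; apply: cvgB; [exact: cvg_cst|exact: cu].
  - by move=> y xy; rewrite subr_ge0 uh.
have iGR : mu.-integrable `](x + e)%R, +oo[ (EFin \o G).
  apply: ge0_integrable_of_integral eR => // y /=; rewrite in_itv/= andbT => xy.
  by rewrite mulr_ge0 ?frac_kernel_ge0// subr_ge0 uh//; lra.
have iGL : mu.-integrable `]-oo, (x - e)%R[ (EFin \o G).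
  have : mu.-integrable `]-oo, (x - e)%R[ (EFin \o (fun y => - G y)).
    apply: ge0_integrable_of_integral eL => //; first exact: measurableT_comp.
    move=> y /=; rewrite in_itv/= => xy; rewrite -mulNr opprB.
    by rewrite mulr_ge0 ?frac_kernel_ge0// subr_ge0 uh//; lra.
  move=> H; have := integrable_scale (-1) (measurable_itv _) H.
  by apply: eq_integrable => // y _ /=; rewrite mulN1r opprK.
have OE : [set y : R | e < `|y - x|] = `]-oo, (x - e)[%classic `|` `](x + e), +oo[%classic.
  apply/seteqP; split => y /=; rewrite !in_itv/= ?andbT.
    by rewrite ltr_normr => /orP[|] H; [right|left]; lra.
  by rewrite ltr_normr => -[] H; apply/orP; [right|left]; lra.
have dj : [disjoint `]-oo, (x - e)[%classic & `](x + e), +oo[%classic : set R].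
  by apply/disj_setPS => y [/=]; rewrite !in_itv/= andbT => H1 H2; lra.
have iG : mu.-integrable [set y | e < `|y - x|] (EFin \o G).
  by rewrite OE; exact: integrable_setU.
split => //.
have -> : (\int[mu]_(y in [set y | (e < `|y - x|)%R]) (G y)%:E =
    (\int[mu]_(y in [set y | (e < `|y - x|)%R]) G y)%R%:E)%E.
  by rewrite /Rintegral fineK//; apply: integrable_fin_num iG; rewrite OE; exact: measurableU.
congr EFin; rewrite OE Rintegral_setU//; last by rewrite -OE.
have -> : \int[mu]_(y in `]-oo, (x - e)[) G y = - IL.
  have : \int[mu]_(y in `]-oo, (x - e)[) (- G y) = IL by rewrite /Rintegral eL.
  move=> <-; rewrite -[RHS]mulN1r -RintegralZl//; last first.
    have := integrable_scale (-1) (measurable_itv _) iGL.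
    by apply: eq_integrable => // y _ /=; rewrite mulN1r.
  by apply: eq_Rintegral => y _; rewrite mulN1r opprK.
have -> : \int[mu]_(y in `](x + e), +oo[) G y = IR by rewrite /Rintegral eR.
rewrite addrC -RintegralB// Rintegral_itv_obnd_cbnd.
  by apply: eq_Rintegral => h _; rewrite /diff2; ring.
have iRL : mu.-integrable `[e, +oo[ (EFin \o (fun h => diff2 u x h * frac_kernel s h)).
  have := @integrableB _ _ _ mu `[e, +oo[ _ _ _ iR iL.
  move=> /(_ (measurable_itv _)); apply: eq_integrable => // h _ /=.
  by rewrite -EFinB; congr EFin; rewrite /diff2; ring.
apply: integrableS iRL => //.
by apply: subset_itvr; rewrite bnd_simp.
Qed.

(** The symmetric cutoff at distance e removes exactly the part 0 < h <= e of [frac_lap], which is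
    of order e^(2-2s). *)
Lemma principal_value s x u (A B : R) : 0 < s < 1 -> continuous u ->
  {homo u : a b / a <= b} -> (forall y, `|u y| <= B) ->
  (forall h, `|diff2 u x h| <= A * h ^+ 2) ->
  (\int[mu]_(y in [set y | (e < `|y - x|)%R]) ((u y - u x) * frac_kernel s `|x - y|)%:E)%E
    @[e --> 0^'+] --> (frac_lap s u x)%:E.
Proof.
move=> s01 cu uh uB HA; have /andP[s0 s1] := s01.
have E e : 0 < e -> (\int[mu]_(y in [set y | (e < `|y - x|)%R])
    ((u y - u x) * frac_kernel s `|x - y|)%:E)%E =
    (frac_lap s u x - \int[mu]_(h in `]0, e]) (diff2 u x h * frac_kernel s h))%:E.
  move=> e0; rewrite (integral_outside x s0 e0 cu uh uB).2.
  rewrite (frac_lap_split (A := A) (B := 4 * B) s01 e0 cu)//.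
    by congr EFin; ring.
  by move=> h _; exact: diff2_bounded.
apply: (@cvg_trans _ ((frac_lap s u x -
    \int[mu]_(h in `]0, e]) (diff2 u x h * frac_kernel s h))%:E @[e --> 0^'+])).
  by apply: near_eq_cvg; near=> e; rewrite E.
apply: cvg_EFin; first by near=> e.
rewrite -[X in _ --> X]subr0; apply: cvgB; first exact: cvg_cst.
have cv : A * (e `^ (2 - 2 * s) / (2 - 2 * s)) @[e --> 0^'+] --> 0.
  rewrite -[X in _ --> X](mulr0 A); apply: cvgMr.
  rewrite -[X in _ --> X](mul0r (2 - 2 * s)^-1); apply: cvgMl.
  by apply: powR_cvg0; lra.
apply/cvgr0Pnorm_le => d d0; near=> e.
have e0 : 0 < e by near: e; exact: nbhs_right_gt.
apply: (le_trans (near_bound s01 e0 cu (fun h _ => HA h))).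
apply: le_trans (ler_norm _) _.
by near: e; move/cvgr0Pnorm_le : cv => /(_ _ d0).
Unshelve. all: by end_near. Qed.

End principal_value.

(** * Layers and their fractional Laplacian *)

(** The study of L_s u and of W sees the solution only through this interface, in which [u j] is the
    j-th derivative. The monotone slope fixes the sign of second differences, the lower bound on the
    slope permits division by u', and the matching powers in the tail convert decay in x into powers
    of 1 - |t|. *)
Record layer (R : realType) (p c C : R) (u : nat -> R -> R) : Prop := Layer {
  layer_p_gt0 : 0 < p;
  layer_c_gt0 : 0 < c;
  layer_derivative : forall j, (j < 4)%N -> has_derivative (u j) (u j.+1);
  layer_odd : forall x, u 0%N (- x) = - u 0%N x;
  layer_even : forall x, u 1%N (- x) = u 1%N x;
  layer_le1 : forall x, `|u 0%N x| <= 1;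
  layer_decay : forall j x, (0 < j <= 4)%N ->
    `|u j x| <= C * (1 + `|x|) `^ (- (j%:R + p));
  layer_slope : forall x, c * (1 + `|x|) `^ (- (1 + p)) <= u 1%N x;
  layer_nincr : forall x y, 0 <= x -> x <= y -> u 1%N y <= u 1%N x;
  layer_tail : forall x, 0 <= x ->
    c * (1 + x) `^ (- p) <= 1 - u 0%N x <= C * (1 + x) `^ (- p) }.

Section layer_theory.
Context {R : realType}.
Notation mu := (@lebesgue_measure R).
Variables (s p c C : R) (u : nat -> R -> R).
Hypothesis s01 : 0 < s < 1.
Hypothesis lu : layer p c C u.

Let s0 : 0 < s. Proof. by case/andP: s01. Qed.
Let s1 : s < 1. Proof. by case/andP: s01. Qed.
Let p0 : 0 < p. Proof. exact: layer_p_gt0 lu. Qed.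
Let c0 : 0 < c. Proof. exact: layer_c_gt0 lu. Qed.

Lemma layer_C_ge0 : 0 <= C.
Proof.
have := layer_tail lu (lexx 0); rewrite addr0 !powR1 !mulr1 => /andP[+ +] => h1 h2.
by apply: le_trans (ltW c0) _; lra.
Qed.
Let C0 := layer_C_ge0.

Lemma layer_slope_gt0 x : 0 < u 1%N x.
Proof.
by apply: lt_le_trans (layer_slope lu x); rewrite mulr_gt0// powR_gt0.
Qed.

Lemma layer_continuous j : (j < 4)%N -> continuous (u j).
Proof. by move=> j4; exact: has_derivative_continuous (layer_derivative lu j4). Qed.

Lemma layer_bounded j x : (0 < j <= 4)%N -> `|u j x| <= C.
Proof.
move=> j4; apply: (le_trans (layer_decay lu x j4)).
apply: (@le_trans _ _ (C * 1 `^ (- (j%:R + p)))); last by rewrite powR1 mulr1.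
rewrite ler_wpM2l//; apply: le0_powR_nincr => //; last by rewrite lerDl.
by rewrite oppr_le0 addr_ge0// ltW.
Qed.

Lemma layer_homo_lt : {homo u 0%N : x y / x < y}.
Proof.
move=> x y xy.
have [z [_ _ E]] := mean_value (layer_derivative lu (j := 0) isT) xy.
by rewrite -subr_gt0 E mulr_gt0 ?layer_slope_gt0 ?subr_gt0.
Qed.

Lemma layer_homo_le : {homo u 0%N : x y / x <= y}.
Proof. by apply: ltW_homo; exact: layer_homo_lt. Qed.

Lemma layer_cvg_pinfty : u 0%N x @[x --> +oo] --> (1 : R).
Proof.
apply/cvgrPdist_le => e e0; near=> x.
have x0 : 0 <= x by near: x; apply: nbhs_pinfty_ge; exact: num_real.
have /andP[h1 h2] := layer_tail lu x0.
rewrite ger0_norm; last first.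
  by apply: le_trans h1; rewrite mulr_ge0 ?powR_ge0// ltW.
apply: (le_trans h2).
apply: (@le_trans _ _ (C * x `^ (- p))).
  rewrite ler_wpM2l//; apply: le0_powR_nincr; rewrite ?oppr_le0 ?ltW//; last lra.
apply: le_trans (ler_norm _) _; near: x.
have : C * x `^ (- p) @[x --> +oo] --> (0 : R).
  by rewrite -[X in _ --> X](mulr0 C); apply: cvgMr; apply: lt0_powR_cvgy; rewrite oppr_lt0.
by move/cvgr0Pnorm_le => /(_ _ e0).
Unshelve. all: by end_near. Qed.

Lemma layer_cvg_ninfty : u 0%N x @[x --> -oo] --> (-1 : R).
Proof.
have -> : u 0%N = (fun x => - u 0%N (- x)).
  by apply/funext => x; rewrite (layer_odd lu) opprK.
apply: cvgN; apply/cvgNy_compNP.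
have -> : (fun x => u 0%N (- - x)) = u 0%N by apply/funext => x; rewrite opprK.
exact: layer_cvg_pinfty.
Qed.

Lemma layer_lt1 x : -1 < u 0%N x < 1.
Proof.
have lt1 y : 0 <= y -> u 0%N y < 1.
  move=> y0; have /andP[h1 _] := layer_tail lu y0.
  by rewrite -subr_gt0; apply: lt_le_trans h1; rewrite mulr_gt0 ?powR_gt0//; lra.
have lt1' y : u 0%N y < 1.
  have [/lt1//|y0] := leP 0 y.
  by apply: le_lt_trans (lt1 0 (lexx _)); apply: layer_homo_le; exact: ltW.
by rewrite lt1' andbT ltrNl -(layer_odd lu) lt1'.
Qed.

(** As a function of h the second difference starts at 0 with derivative u'(x+t) - u'(x-t). This is
    nonpositive because u' is even and decreasing in |x|, and |x-t| <= x+t. *)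
Lemma layer_diff2_le0 x h : 0 <= x -> 0 <= h -> diff2 (u 0%N) x h <= 0.
Proof.
move=> x0 h0.
pose g := diff2 (u 0%N) x.
have d0 := layer_derivative lu (isT : (0 < 4)%N).
have dg (t : R) : is_derive t 1 g (u 1%N (x + t) - u 1%N (x - t)).
  have G1 := has_derivative_affine 1 x d0 t.
  have G2 := has_derivative_affine (-1) x d0 t.
  have -> : g = (fun t => u 0%N (1 * t + x) + u 0%N (-1 * t + x) - 2 * u 0%N x).
    by apply/funext => y; rewrite /g /diff2 mul1r mulN1r !(addrC _ x).
  apply: is_derive_eq; rewrite /GRing.scale/= !mul1r !mulN1r !(addrC _ x); ring.
have [t + E] : exists2 t, t \in `[0, h] & g h - g 0 = (u 1%N (x + t) - u 1%N (x - t)) * (h - 0).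
  apply: MVT_segment => //; apply: continuous_subspaceT.
  exact: (has_derivative_continuous dg).
rewrite in_itv/= => /andP[t0 th].
have g0 : g 0 = 0 by rewrite /g /diff2 !(addr0, subr0); ring.
have : g h <= 0.
  rewrite -[g h]subr0 -{1}g0 E subr0 mulr_le0_ge0// subr_le0.
  have [xt|xt] := leP 0 (x - t); first by apply: layer_nincr lu _ _ _ _ => //; lra.
  by rewrite -(layer_even lu (x - t)); apply: layer_nincr lu _ _ _ _; lra.
by [].
Qed.

(* The radius is such that [1 + |z| >= (1 + x) / 2] as long as [|z - x| <= (1 + x) / 2]. *)
Lemma layer_diff2_bound j x h : (j <= 2)%N -> 0 <= x -> `|h| <= (1 + x) / 2 ->
  `|diff2 (u j) x h| <= 2 * (C * ((1 + x) / 2) `^ (- (j.+2%:R + p))) * h ^+ 2.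
Proof.
move=> j2 x0 hx.
have dj := layer_derivative lu (leq_trans (j2 : (j < 3)%N) (isT : (3 <= 4)%N)).
have dj1 := layer_derivative lu (j2 : (j.+1 < 4)%N).
apply: diff2_quadratic dj dj1 _ => z zx.
apply: (le_trans (layer_decay lu z _)) => //.
rewrite ler_wpM2l//; apply: le0_powR_nincr.
- by rewrite oppr_le0 addr_ge0// ltW.
- lra.
- have : `|x| <= `|z| + `|h|.
    by rewrite -[x in `|x|](subrK z) addrC; apply: le_trans (ler_normD _ _) _; rewrite lerD2l distrC.
  by rewrite (ger0_norm x0); lra.
Qed.

Lemma layer_frac_lap_integrable j x : (j <= 2)%N ->
  mu.-integrable `]0, +oo[ (EFin \o (fun h => diff2 (u j) x h * frac_kernel s h)).
Proof.
move=> j2.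
have dj := layer_derivative lu (leq_trans (j2 : (j < 3)%N) (isT : (3 <= 4)%N)).
have dj1 := layer_derivative lu (j2 : (j.+1 < 4)%N).
apply: (@diff2_integrable _ _ _ _ (2 * C) (4 * (1 + C)) 1) => //.
- exact: has_derivative_continuous dj.
- move=> h _; apply: diff2_quadratic dj dj1 _ => z _; exact: layer_bounded.
- move=> h _; apply: diff2_bounded => y.
  case: (posnP j) => [->|j0]; first by apply: le_trans (layer_le1 lu y) _; rewrite lerDl.
  apply: (@le_trans _ _ C); last by rewrite lerDr.
  by apply: layer_bounded; rewrite j0 (leq_trans j2).
Qed.

Lemma layer_frac_lap_le0 x : 0 <= x -> frac_lap s (u 0%N) x <= 0.
Proof.
move=> x0; rewrite -oppr_ge0 -mulN1r -RintegralZl//; last exact: layer_frac_lap_integrable.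
apply: Rintegral_ge0 => h /=; rewrite in_itv/= andbT => h0.
rewrite mulN1r oppr_ge0 mulr_le0_ge0 ?frac_kernel_ge0//.
by apply: layer_diff2_le0 => //; exact: ltW.
Qed.

Lemma layer_frac_lap_odd x : frac_lap s (u 0%N) (- x) = - frac_lap s (u 0%N) x.
Proof.
rewrite -[RHS]mulN1r -RintegralZl//; last exact: layer_frac_lap_integrable.
apply: eq_Rintegral => h _; rewrite mulrA; congr (_ * _).
have e1 : - x + h = - (x - h) by ring.
have e2 : - x - h = - (x + h) by ring.
rewrite /diff2 e1 e2 !(layer_odd lu); ring.
Qed.

Lemma layer_frac_lap_even x : frac_lap s (u 1%N) (- x) = frac_lap s (u 1%N) x.
Proof.
apply: eq_Rintegral => h _; congr (_ * _).
have e1 : - x + h = - (x - h) by ring.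
have e2 : - x - h = - (x + h) by ring.
rewrite /diff2 e1 e2 !(layer_even lu); ring.
Qed.

End layer_theory.

(** * Decay rates of L_s u and of its first two derivatives *)

Section layer_asymptotics.
Context {R : realType}.
Notation mu := (@lebesgue_measure R).
Variables (s p c C : R) (u : nat -> R -> R).
Hypothesis s01 : 0 < s < 1.
Hypothesis lu : layer p c C u.

Let s0 : 0 < s. Proof. by case/andP: s01. Qed.
Let s1 : s < 1. Proof. by case/andP: s01. Qed.
Let p0 : 0 < p. Proof. exact: layer_p_gt0 lu. Qed.
Let c0 : 0 < c. Proof. exact: layer_c_gt0 lu. Qed.
Let C0 : 0 <= C. Proof. exact: layer_C_ge0 lu. Qed.

(** The integral is 1 - u(x+r), hence below the total variation 2 of u, uniformly in the shift. *)
Lemma layer_mass_right x r :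
  mu.-integrable `]r, +oo[ (EFin \o (fun h => u 1%N (x + h))) /\
  \int[mu]_(h in `]r, +oo[) u 1%N (x + h) <= 2.
Proof.
have dF (h : R) : is_derive h 1 (fun h => u 0%N (x + h)) (u 1%N (x + h)).
  have := has_derivative_affine 1 x (layer_derivative lu (isT : (0 < 4)%N)) h.
  by rewrite !mul1r addrC; under eq_fun do rewrite mul1r addrC.
have cf : continuous (fun h => u 1%N (x + h)).
  move=> h; apply: (continuous_comp (f := fun h => x + h)).
    by apply: cvgD; [exact: cvg_cst|exact: cvg_id].
  exact: (layer_continuous lu (isT : (1 < 4)%N)).
have I : (\int[mu]_(h in `[r, +oo[) (u 1%N (x + h))%:E = (1 - u 0%N (x + r))%:E)%E.
  rewrite (@ge0_continuous_FTC2y _ _ (fun h => u 0%N (x + h)) r 1)//.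
  - by move=> h _; exact/ltW/(layer_slope_gt0 lu).
  - exact: continuous_subspaceT.
  - apply: cvg_comp (layer_cvg_pinfty lu).
    apply/cvgryPge => A; near=> h; rewrite -lerBlDl.
    by near: h; apply: nbhs_pinfty_ge; exact: num_real.
  - by apply: cvg_at_right_filter; exact: (has_derivative_continuous dF).
  - by move=> h _; rewrite derive1E; have [_ ->] := dF h.
rewrite -integral_itv_obnd_cbnd in I; last first.
  by apply/measurable_EFinP/measurable_funTS; exact: continuous_measurable_fun.
split.
  apply: ge0_integrable_of_integral I => //.
    by apply/measurable_funTS; exact: continuous_measurable_fun.
  by move=> h _; exact/ltW/(layer_slope_gt0 lu).
rewrite /Rintegral I /=; have := layer_lt1 lu (x + r); lra.
Unshelve. all: by end_near. Qed.

Lemma layer_mass_left x r :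
  mu.-integrable `]r, +oo[ (EFin \o (fun h => u 1%N (x - h))) /\
  \int[mu]_(h in `]r, +oo[) u 1%N (x - h) <= 2.
Proof.
have -> : (fun h => u 1%N (x - h)) = (fun h => u 1%N (- x + h)).
  by apply/funext => h; rewrite -(layer_even lu) opprB addrC.
exact: layer_mass_right.
Qed.

(** Every derivative decays at least as fast as the lower bound of u', so the finite mass of u'
    controls the mass of all of them. *)
Lemma layer_dominated j x : (0 < j <= 4)%N -> `|u j x| <= C / c * u 1%N x.
Proof.
move=> j4; have j1 : (0 < j)%N by case/andP: j4.
apply: (le_trans (layer_decay lu x j4)).
rewrite -mulrA ler_wpM2l// ler_pdivlMl//.
apply: le_trans (layer_slope lu x); rewrite ler_wpM2l//; first exact: ltW.
apply: ler_powR; first by rewrite lerDl.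
by rewrite lerN2 lerD2r (ler_nat R 1).
Qed.

(** Bounding the second difference by a constant would only give r^(-2s). The missing power comes
    from taking the kernel out at its maximum [frac_kernel s r] and integrating the shifted terms,
    whose mass is finite; only the term at x itself meets the full kernel integral, and it carries
    its own decay. *)
Lemma layer_far j x r : (0 < j <= 2)%N -> 0 < r ->
  `|\int[mu]_(h in `]r, +oo[) (diff2 (u j) x h * frac_kernel s h)| <=
   4 * (C / c) * frac_kernel s r + 2 * `|u j x| * (r `^ (- (2 * s)) / (2 * s)).
Proof.
move=> /andP[j1 j2] r0.
have j4 : (0 < j <= 4)%N by rewrite j1 (leq_trans j2).
have [iR mR] := layer_mass_right x r; have [iL mL] := layer_mass_left x r.
have i1 : mu.-integrable `]r, +oo[ (EFin \o (fun h => diff2 (u j) x h * frac_kernel s h)).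
  apply: integrableS (layer_frac_lap_integrable s01 lu x j2) => //.
  by apply: subset_itvr; rewrite bnd_simp ltW.
have iK : mu.-integrable `]r, +oo[ (EFin \o frac_kernel s).
  apply: integrableS (integrable_frac_kernel s0 r0) => //.
  by apply: subset_itvr; rewrite bnd_simp.
have mI : measurable (`]r, +oo[%classic : set (measurableTypeR R)) by exact: measurable_itv.
pose D := C / c * frac_kernel s r.
have D0 : 0 <= D by rewrite mulr_ge0 ?frac_kernel_ge0// divr_ge0// ltW.
pose g h := D * (u 1%N (x + h) + u 1%N (x - h)) + 2 * `|u j x| * frac_kernel s h.
have ig1 : mu.-integrable `]r, +oo[ (EFin \o (fun h => u 1%N (x + h) + u 1%N (x - h))).
  by have := @integrableD _ _ _ mu _ mI _ _ iR iL; apply: eq_integrable.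
have ig2 := integrable_scale D mI ig1.
have ig3 := integrable_scale (2 * `|u j x|) mI iK.
have ig : mu.-integrable `]r, +oo[ (EFin \o g).
  by have := @integrableD _ _ _ mu _ mI _ _ ig2 ig3; apply: eq_integrable.
apply: (le_trans (le_normr_Rintegral mI i1)).
apply: (@le_trans _ _ (\int[mu]_(h in `]r, +oo[) g h)).
  apply: le_Rintegral => //.
    by have := integrable_norm i1; apply: eq_integrable.
  move=> h; rewrite /= in_itv/= andbT => rh.
  rewrite normrM (ger0_norm (frac_kernel_ge0 _ _)) /g.
  have b1 := layer_dominated (x + h) j4; have b2 := layer_dominated (x - h) j4.
  have Kh := frac_kernel_ge0 s h.
  have Kr : frac_kernel s h <= frac_kernel s r by apply: frac_kernel_nincr => //; exact: ltW.
  apply: (@le_trans _ _ ((`|u j (x + h)| + `|u j (x - h)| + 2 * `|u j x|) * frac_kernel s h)).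
    rewrite ler_wpM2r// /diff2; apply: (le_trans (ler_normB _ _)).
    by rewrite normrM (ger0_norm (ler0n _ 2)) lerD2r ler_normD.
  rewrite mulrDl lerD2r.
  have -> : D * (u 1%N (x + h) + u 1%N (x - h)) =
      (C / c * (u 1%N (x + h) + u 1%N (x - h))) * frac_kernel s r by rewrite /D; ring.
  apply: ler_pM; rewrite ?addr_ge0//.
  by rewrite mulrDr lerD.
rewrite RintegralD// !RintegralZl// RintegralD// Rintegral_frac_kernel_infty//.
rewrite lerD2r (_ : 4 * (C / c) * _ = D * 4); last by rewrite /D; ring.
by rewrite ler_wpM2l//; lra.
Qed.

Lemma powRN_half_le (r a : R) : 2^-1 <= r -> 0 <= a -> r `^ (- a) <= 2 `^ a.
Proof.
move=> r2 a0; have -> : 2 `^ a = (2^-1) `^ (- a) :> R.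
  by rewrite -powR_inv1// -powRrM mulN1r opprK.
by apply: le0_powR_nincr; rewrite ?oppr_le0// invr_gt0.
Qed.

Lemma powR_split (r a b : R) : 0 < r -> r `^ (a + b) = r `^ a * r `^ b.
Proof. by move=> r0; rewrite powRD// (gt_eqF r0) implybT. Qed.

(** On the ball of radius r = (1+x)/2 the second derivative of [u j] is of order r^(-(j+2+p)), and
    integrating h^2 against the kernel returns r^(2-2s). *)
Lemma layer_near j x : (j <= 2)%N -> 0 <= x ->
  `|\int[mu]_(h in `]0, (1 + x) / 2]) (diff2 (u j) x h * frac_kernel s h)| <=
   C / (1 - s) * ((1 + x) / 2) `^ (- (j%:R + p + 2 * s)).
Proof.
move=> j2 x0; set r := (1 + x) / 2.
have r0 : 0 < r by rewrite /r; lra.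
have cj : continuous (u j) by apply: (layer_continuous lu); exact: leq_ltn_trans j2 _.
have H h : 0 < h <= r -> `|diff2 (u j) x h| <= 2 * (C * r `^ (- (j.+2%:R + p))) * h ^+ 2.
  by move=> /andP[h0 hr]; apply: (layer_diff2_bound lu) => //; rewrite gtr0_norm.
apply: (le_trans (near_bound s01 r0 cj H)).
have -> : - (j%:R + p + 2 * s) = - (j.+2%:R + p) + (2 - 2 * s) :> R.
  by rewrite -addn2 natrD; ring.
rewrite (powR_split (- (j.+2%:R + p)) _ r0) le_eqVlt; apply/orP; left; apply/eqP.
have /andP[_ s1'] := s01.
by field; apply/andP; split; rewrite lt0r_neq0//; lra.
Qed.

Lemma layer_frac_lap_split j x : (j <= 2)%N -> 0 <= x ->
  frac_lap s (u j) x =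
  \int[mu]_(h in `]0, (1 + x) / 2]) (diff2 (u j) x h * frac_kernel s h) +
  \int[mu]_(h in `](1 + x) / 2, +oo[) (diff2 (u j) x h * frac_kernel s h).
Proof.
move=> j2 x0; have r0 : 0 < (1 + x) / 2 by lra.
rewrite /frac_lap (itv0y_split r0) Rintegral_setU//.
- by rewrite -(itv0y_split r0); exact: (layer_frac_lap_integrable s01 lu).
- exact: disjoint_itv0y.
Qed.


(** Here u itself does not decay, so the far part is just 4 times the kernel mass, of order r^(-2s);
    the near part is smaller by r^(-p), which r >= 1/2 bounds by 2^p. *)
Lemma layer_frac_lap_bound0 :
  exists2 K, 0 <= K & forall x, 0 <= x ->
    `|frac_lap s (u 0%N) x| <= K * (1 + x) `^ (- (2 * s)).
Proof.
have /andP[s0' s1'] := s01.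
have a0 : 0 <= 2 * s by rewrite mulr_ge0// ltW.
have P2 : 0 <= 2 `^ p :> R := powR_ge0 _ _.
pose K := (C / (1 - s) * 2 `^ p + 2 / s) * 2 `^ (2 * s).
have K1 : 0 <= C / (1 - s) by rewrite divr_ge0// subr_ge0 ltW.
have K2 : 0 <= 2 / s by rewrite divr_ge0// ltW.
exists K; first by rewrite mulr_ge0 ?powR_ge0// addr_ge0// mulr_ge0.
move=> x x0; rewrite layer_frac_lap_split//.
have r0 : 0 < (1 + x) / 2 by lra.
have r2 : 2^-1 <= (1 + x) / 2 by lra.
have rE : ((1 + x) / 2) `^ (- (2 * s)) = 2 `^ (2 * s) * (1 + x) `^ (- (2 * s)).
  rewrite powRM ?invr_ge0; [|lra|lra]; rewrite mulrC; congr (_ * _).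
  by rewrite -powR_inv1// -powRrM mulN1r opprK.
apply: (le_trans (ler_normD _ _)).
have hn := layer_near (isT : (0 <= 2)%N) x0.
have hf : `|\int[mu]_(h in `](1 + x) / 2, +oo[) (diff2 (u 0%N) x h * frac_kernel s h)|
    <= 4 * (((1 + x) / 2) `^ (- (2 * s)) / (2 * s)).
  apply: far_bound => //; first exact: (layer_continuous lu (isT : (0 < 4)%N)).
  move=> h _; have := diff2_bounded x h (layer_le1 lu); by rewrite mulr1.
apply: (le_trans (lerD hn hf)).
have -> : K * (1 + x) `^ (- (2 * s)) =
    (C / (1 - s) * 2 `^ p + 2 / s) * ((1 + x) / 2) `^ (- (2 * s)) by rewrite rE /K; ring.
rewrite [leRHS]mulrDl; apply: lerD.
  rewrite -[X in _ <= X]mulrA ler_wpM2l//.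
  rewrite (_ : - (0%:R + p + 2 * s) = - p + - (2 * s)); last by rewrite add0r opprD.
  rewrite powR_split// ler_wpM2r ?powR_ge0//.
  by apply: powRN_half_le => //; exact: ltW.
rewrite le_eqVlt; apply/orP; left; apply/eqP; field.
by rewrite lt0r_neq0.
Qed.

(** The near part and the term at x have exponent j+p+2s, which exceeds 1+2s by j-1+p >= 0; the
    surplus is absorbed using r >= 1/2. The mass term has the exponent 1+2s exactly. *)
Lemma layer_frac_lap_bound j : (0 < j <= 2)%N ->
  exists2 K, 0 <= K & forall x, 0 <= x ->
    `|frac_lap s (u j) x| <= K * (1 + x) `^ (- (1 + 2 * s)).
Proof.
have /andP[s0' s1'] := s01.
move=> j12; have /andP[j1 j2] := j12.
have j4 : (0 < j <= 4)%N by rewrite j1 (leq_trans j2).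
have K1 : 0 <= C / (1 - s) by rewrite divr_ge0// subr_ge0 ltW.
have K2 : 0 <= C / c by rewrite divr_ge0// ltW.
have K3 : 0 <= C / s by rewrite divr_ge0// ltW.
have e0 : 0 <= j%:R - 1 + p :> R.
  by rewrite addr_ge0 ?(ltW p0)// subr_ge0 (ler_nat R 1).
pose K := (C / (1 - s) * 2 `^ (j%:R - 1 + p) + 4 * (C / c) + C / s * 2 `^ (j%:R - 1 + p))
   * 2 `^ (1 + 2 * s).
have P2 : 0 <= 2 `^ (j%:R - 1 + p) :> R := powR_ge0 _ _.
exists K; first by rewrite mulr_ge0 ?powR_ge0// !addr_ge0// mulr_ge0.
move=> x x0; rewrite layer_frac_lap_split//.
set r := (1 + x) / 2.
have r0 : 0 < r by rewrite /r; lra.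
have r2 : 2^-1 <= r by rewrite /r; lra.
have rE : r `^ (- (1 + 2 * s)) = 2 `^ (1 + 2 * s) * (1 + x) `^ (- (1 + 2 * s)).
  rewrite /r powRM ?invr_ge0; [|lra|lra]; rewrite mulrC; congr (_ * _).
  by rewrite -powR_inv1// -powRrM mulN1r opprK.
apply: (le_trans (ler_normD _ _)).
apply: (le_trans (lerD (layer_near j2 x0) (layer_far x j12 r0))).
have -> : K * (1 + x) `^ (- (1 + 2 * s)) = (C / (1 - s) * 2 `^ (j%:R - 1 + p) +
    4 * (C / c) + C / s * 2 `^ (j%:R - 1 + p)) * r `^ (- (1 + 2 * s)) by rewrite rE /K; ring.
rewrite [leRHS]mulrDl; rewrite [X in _ <= X + _]mulrDl -[leRHS]addrA.
apply: lerD; last apply: lerD.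
- rewrite -[X in _ <= X]mulrA ler_wpM2l//.
  have -> : - (j%:R + p + 2 * s) = - (j%:R - 1 + p) + - (1 + 2 * s) by ring.
  rewrite powR_split// ler_wpM2r ?powR_ge0//.
  exact: powRN_half_le.
- rewrite le_eqVlt; apply/orP; left; apply/eqP; congr (_ * _ `^ _); ring.
- have hu : `|u j x| <= C * r `^ (- (j%:R + p)).
    apply: (le_trans (layer_decay lu x j4)); rewrite ler_wpM2l//.
    apply: le0_powR_nincr => //; first by rewrite oppr_le0 addr_ge0// ltW.
    by rewrite ger0_norm// /r; lra.
  apply: (@le_trans _ _ (C / s * (r `^ (- (j%:R + p)) * r `^ (- (2 * s))))).
    have -> : 2 * `|u j x| * (r `^ (- (2 * s)) / (2 * s)) =
       `|u j x| * (r `^ (- (2 * s)) / s) by field; rewrite lt0r_neq0.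
    have -> : C / s * (r `^ (- (j%:R + p)) * r `^ (- (2 * s))) =
       (C * r `^ (- (j%:R + p))) * (r `^ (- (2 * s)) / s) by field; rewrite lt0r_neq0.
    by rewrite ler_wpM2r// divr_ge0 ?powR_ge0// ltW.
  rewrite -[X in _ <= X]mulrA ler_wpM2l// -powR_split//.
  have -> : - (j%:R + p) + - (2 * s) = - (j%:R - 1 + p) + - (1 + 2 * s) by ring.
  rewrite powR_split// ler_wpM2r ?powR_ge0//.
  exact: powRN_half_le.
Qed.

(** The leading contribution is u'(x-h) for h within 1 of x, where x-h sweeps the transition around
    0: there u' is at least m and the kernel at least (1+x)^(-1-2s), over a length 2. All negative
    contributions have the extra factor (1+x)^(-p). *)
Lemma layer_frac_lap_lower :
  exists k X, [/\ 0 < k, 0 <= X & forall x, X <= x ->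
    k * (1 + x) `^ (- (1 + 2 * s)) <= frac_lap s (u 1%N) x].
Proof.
have /andP[s0' s1'] := s01.
have mI (r : R) : measurable (`]r, +oo[%classic : set (measurableTypeR R)) by exact: measurable_itv.
pose m := c * 2 `^ (- (1 + p)).
have m0 : 0 < m by rewrite mulr_gt0// powR_gt0.
pose D := C / (1 - s) + C / s.
have D0 : 0 <= D by rewrite addr_ge0// divr_ge0// ?subr_ge0 ltW.
(* The threshold 4 guarantees x - 1 > (1+x)/2, so that [x-1, x+1] lies in the far region. *)
have key x : 4 <= x -> m * 2 * (1 + x) `^ (- (1 + 2 * s)) -
    D * ((1 + x) / 2) `^ (- (1 + p + 2 * s)) <= frac_lap s (u 1%N) x.
  move=> x4; have x0 : 0 <= x by lra.
  rewrite layer_frac_lap_split//; set r := (1 + x) / 2.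
  have r0 : 0 < r by rewrite /r; lra.
  have hn := layer_near (isT : (1 <= 2)%N) x0; rewrite -/r in hn.
  have [iL _] := layer_mass_left x r.
  have iK : mu.-integrable `]r, +oo[ (EFin \o frac_kernel s).
    apply: integrableS (integrable_frac_kernel s0 r0) => //.
    by apply: subset_itvr; rewrite bnd_simp.
  have i1 : mu.-integrable `]r, +oo[ (EFin \o (fun h => diff2 (u 1%N) x h * frac_kernel s h)).
    apply: integrableS (layer_frac_lap_integrable s01 lu x (isT : (1 <= 2)%N)) => //.
    by apply: subset_itvr; rewrite bnd_simp ltW.
  have cu1 : continuous (fun h => u 1%N (x - h)).
    move=> h; apply: (continuous_comp (f := fun h => x - h)).
      by apply: cvgB; [exact: cvg_cst|exact: cvg_id].
    exact: (layer_continuous lu (isT : (1 < 4)%N)).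
  have iLK : mu.-integrable `]r, +oo[ (EFin \o (fun h => u 1%N (x - h) * frac_kernel s h)).
    apply: integrableS (@bounded_kernel_integrable _ s r _ C s0 r0 cu1 _) => //.
      by apply: subset_itvr; rewrite bnd_simp.
    by move=> h; exact: (layer_bounded lu).
  pose A : set R := `[x - 1, x + 1]%classic.
  have AI : A `<=` `]r, +oo[.
    by move=> h; rewrite /A /= !in_itv/= andbT /r => /andP[h1 h2]; lra.
  have mA : measurable (A : set (measurableTypeR R)) by exact: measurable_itv.
  have hA : m * 2 * (1 + x) `^ (- (1 + 2 * s)) <=
      \int[mu]_(h in `]r, +oo[) (u 1%N (x - h) * frac_kernel s h).
    have iA := integrableS (mI r) mA AI iLK.
    apply: (@le_trans _ _ (\int[mu]_(h in A) (u 1%N (x - h) * frac_kernel s h))).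
      have -> : m * 2 * (1 + x) `^ (- (1 + 2 * s)) =
          \int[mu]_(h in A) (m * (1 + x) `^ (- (1 + 2 * s))).
        rewrite Rintegral_cst//= lebesgue_measure_itv/= lte_fin.
        have -> : x - 1 < x + 1 by lra.
        by rewrite -EFinB /=; ring.
      apply: le_Rintegral => //.
        apply/integrableP; split; first exact: measurable_cst.
        rewrite integral_cst//= lebesgue_measure_itv/= lte_fin.
        have -> : x - 1 < x + 1 by lra.
        by rewrite -EFinB -EFinM ltry.
      move=> h; rewrite /A /= in_itv/= => /andP[h1 h2].
      apply: ler_pM; rewrite ?powR_ge0//; first exact: ltW.
        apply: le_trans (layer_slope lu _); rewrite ler_wpM2l ?(ltW c0)//.
        apply: le0_powR_nincr; first by rewrite oppr_le0 addr_ge0// ltW.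
          by rewrite ltr_wpDr.
        suff : `|x - h| <= 1 by lra.
        by rewrite ler_norml; lra.
      rewrite /frac_kernel opprD; apply: le0_powR_nincr; lra.
    rewrite /Rintegral fine_le//.
    - exact: (integrable_fin_num mA iA).
    - exact: (integrable_fin_num (mI r) iLK).
    apply: ge0_subset_integral => //.
      by have /integrableP[] := iLK.
    by move=> h _; rewrite lee_fin mulr_ge0 ?frac_kernel_ge0// ltW// (layer_slope_gt0 lu).
  have ub : u 1%N x <= C * r `^ (- (1 + p)).
    apply: le_trans (ler_norm _) _.
    apply: (le_trans (layer_decay lu x (isT : (0 < 1 <= 4)%N))); rewrite ler_wpM2l//.
    apply: le0_powR_nincr => //; first by rewrite oppr_le0 addr_ge0// ltW.
    by rewrite ger0_norm// /r; lra.
  have hf : m * 2 * (1 + x) `^ (- (1 + 2 * s)) - C / s * r `^ (- (1 + p + 2 * s)) <=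
      \int[mu]_(h in `]r, +oo[) (diff2 (u 1%N) x h * frac_kernel s h).
    (* The term u'(x+h) is positive and is dropped. *)
    apply: (@le_trans _ _ (\int[mu]_(h in `]r, +oo[)
        (u 1%N (x - h) * frac_kernel s h - 2 * u 1%N x * frac_kernel s h))).
      rewrite RintegralB//; last exact: integrable_scale.
      rewrite RintegralZl// Rintegral_frac_kernel_infty//; apply: lerB => //.
      have -> : - (1 + p + 2 * s) = - (1 + p) + - (2 * s) by ring.
      rewrite powR_split//.
      have -> : 2 * u 1%N x * (r `^ (- (2 * s)) / (2 * s)) =
         u 1%N x * (r `^ (- (2 * s)) / s) by field; rewrite lt0r_neq0.
      have -> : C / s * (r `^ (- (1 + p)) * r `^ (- (2 * s))) =
         (C * r `^ (- (1 + p))) * (r `^ (- (2 * s)) / s) by field; rewrite lt0r_neq0.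
      by rewrite ler_wpM2r// divr_ge0 ?powR_ge0// ltW.
    have i2 := integrable_scale (2 * u 1%N x) (mI r) iK.
    apply: le_Rintegral => //.
      by have := @integrableB _ _ _ mu _ (mI r) _ _ iLK i2; apply: eq_integrable.
    move=> h _; rewrite -mulrBl ler_wpM2r ?frac_kernel_ge0// /diff2.
    by have := layer_slope_gt0 lu (x + h); lra.
  have hn' : - (C / (1 - s) * r `^ (- (1 + p + 2 * s))) <=
     \int[mu]_(h in `]0, r]) (diff2 (u 1%N) x h * frac_kernel s h).
    by rewrite lerNl; apply: le_trans (ler_norm _) _; rewrite normrN.
  have := lerD hn' hf; apply: le_trans; rewrite /D; lra.
pose B := D * 2 `^ (1 + p + 2 * s).
have B0 : 0 <= B by rewrite mulr_ge0// powR_ge0.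
(* For large x the error uses up at most m of the available 2m. *)
have : B * x `^ (- p) @[x --> +oo] --> (0 : R).
  rewrite -[X in _ --> X](mulr0 B); apply: cvgMr; apply: lt0_powR_cvgy.
  by rewrite oppr_lt0.
move/cvgr0Pnorm_le => /(_ _ m0) [X [Xr HX]].
exists m, (Num.max 4 (X + 1)); split => //; first by rewrite le_max; apply/orP; left; lra.
move=> x; rewrite ge_max => /andP[x4 xX].
apply: le_trans (key x x4).
have x1 : 0 < 1 + x by lra.
have -> : ((1 + x) / 2) `^ (- (1 + p + 2 * s)) =
    2 `^ (1 + p + 2 * s) * ((1 + x) `^ (- p) * (1 + x) `^ (- (1 + 2 * s))).
  rewrite -powR_split// powRM ?invr_ge0; [|lra|lra]; rewrite mulrC; congr (_ * _).
    by rewrite -powR_inv1// -powRrM mulN1r opprK.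
  by congr (_ `^ _); ring.
have hB : B * (1 + x) `^ (- p) <= m.
  apply: le_trans (ler_norm _) _; apply: HX; lra.
have hm := powR_ge0 (1 + x) (- (1 + 2 * s)).
rewrite mulrA -/B mulrA -mulrBl ler_wpM2r//.
lra.
Qed.

End layer_asymptotics.

(** * Geometric averages and the step profile *)

Section geometric_mean.
Context {R : realType}.
Variable q : R.
Hypothesis q01 : 0 < q < 1.
Implicit Types (a b : nat -> R) (M : R).

(** The factor 1-q normalises the weights to total mass 1, so constants are reproduced and bounds
    uniform in k pass to the average unchanged. *)
Definition geom_mean a : R := limn (series (fun k => (1 - q) * q ^+ k * a k)).

Let weight_ge0 k : 0 <= (1 - q) * q ^+ k.
Proof. by have /andP[q0 q1] := q01; rewrite mulr_ge0 ?exprn_ge0 ?subr_ge0// ltW. Qed.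

Let bounded_by a M := forall k, `|a k| <= M.

Lemma geom_mean_cst M : geom_mean (fun=> M) = M /\
  cvgn (series (fun k => (1 - q) * q ^+ k * M)).
Proof.
have /andP[q0 q1] := q01.
have qn : `|q| < 1 by rewrite gtr0_norm.
have E : (fun k => (1 - q) * q ^+ k * M) = geometric ((1 - q) * M) q.
  by apply/funext => k; rewrite /geometric /=; ring.
have cv := @cvg_geometric_series _ ((1 - q) * M) _ qn.
split; last by rewrite E; apply/cvg_ex; eexists; exact: cv.
rewrite /geom_mean E; have -> := cvg_lim _ cv => //.
by field; lra.
Qed.

Lemma geom_mean_cvg a M : bounded_by a M ->
  cvgn (series (fun k => (1 - q) * q ^+ k * a k)).
Proof.
move=> aM; apply: normed_cvg.
apply: (series_le_cvg _ _ _ (geom_mean_cst M).2) => k /=.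
- exact: normr_ge0.
- by rewrite mulr_ge0//; apply: le_trans (aM 0%N).
- by rewrite normrM (ger0_norm (weight_ge0 k)) ler_wpM2l.
Qed.

Lemma geom_meanD a b M N : bounded_by a M -> bounded_by b N ->
  geom_mean (fun k => a k + b k) = geom_mean a + geom_mean b.
Proof.
move=> /geom_mean_cvg ca /geom_mean_cvg cb; rewrite /geom_mean -lim_seriesD//.
by congr (limn (series _)); apply/funext => k; rewrite /= mulrDr.
Qed.

Lemma geom_meanZ a M c : bounded_by a M ->
  geom_mean (fun k => c * a k) = c * geom_mean a.
Proof.
move=> /geom_mean_cvg ca; rewrite /geom_mean -[RHS]/(c *: _) -lim_seriesZ//.
by congr (limn (series _)); apply/funext => k; rewrite /GRing.scale/= mulrCA.
Qed.

Lemma geom_mean_le a b M N : bounded_by a M -> bounded_by b N ->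
  (forall k, a k <= b k) -> geom_mean a <= geom_mean b.
Proof.
move=> /geom_mean_cvg ca /geom_mean_cvg cb ab; apply: lim_series_le => // k.
by rewrite ler_wpM2l.
Qed.

Lemma geom_mean_norm a M : bounded_by a M -> `|geom_mean a| <= M.
Proof.
move=> aM; have M0 : 0 <= M := le_trans (normr_ge0 _) (aM 0%N).
have bM (x : R) : `|x| <= M -> bounded_by (fun=> x) M by move=> H k.
rewrite ler_norml; apply/andP; split.
  rewrite -(geom_mean_cst (- M)).1; apply: (geom_mean_le (bM _ _) aM _).
    by rewrite normrN ger0_norm.
  by move=> k; have := aM k; rewrite ler_norml => /andP[].
rewrite -[leRHS](geom_mean_cst M).1; apply: (geom_mean_le aM (bM _ _) _).
  by rewrite ger0_norm.
by move=> k; have := aM k; rewrite ler_norml => /andP[].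
Qed.

Lemma geom_mean_shift a M : bounded_by a M ->
  geom_mean a = (1 - q) * a 0%N + q * geom_mean (fun k => a k.+1).
Proof.
move=> aM; have ca := geom_mean_cvg aM.
have ca1 : cvgn (series (fun k => (1 - q) * q ^+ k * a k.+1)).
  by apply: (@geom_mean_cvg _ M) => k; exact: aM.
rewrite /geom_mean; apply/cvg_lim => //; rewrite -cvg_shiftS.
have -> : [sequence series (fun k => (1 - q) * q ^+ k * a k) n.+1]_n =
    (fun n => (1 - q) * a 0%N + q * series (fun k => (1 - q) * q ^+ k * a k.+1) n).
  apply/funext => n; rewrite /series /= big_nat_recl// expr0 mulr1 big_distrr/=.
  by congr (_ + _); apply: eq_bigr => i _; rewrite exprS; ring.
by apply: cvgD; [exact: cvg_cst|apply: cvgMr; exact: ca1].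
Qed.

(** The indices from N on have total weight q^N: each vanishing leading term lets the shift formula
    extract one factor q. *)
Lemma geom_mean_tail a A N : (forall k, (k < N)%N -> a k = 0) ->
  (forall k, (N <= k)%N -> `|a k| <= A) -> `|geom_mean a| <= A * q ^+ N.
Proof.
have /andP[q0 q1] := q01.
elim: N a => [|N IH] a a0 aA.
  by rewrite expr0 mulr1; apply: geom_mean_norm => k; exact: aA.
have A0 : 0 <= A := le_trans (normr_ge0 _) (aA _ (leqnn _)).
have bA : bounded_by a A.
  by move=> k; have [/aA//|/a0->] := leqP N.+1 k; rewrite normr0.
rewrite (geom_mean_shift bA) a0// mulr0 add0r normrM gtr0_norm//.
rewrite exprS mulrCA ler_wpM2l//; first exact: ltW.
by apply: IH => k kN; [exact: a0|exact: aA].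
Qed.

Lemma geom_mean_ge_term a M N : bounded_by a M -> (forall k, 0 <= a k) ->
  (1 - q) * q ^+ N * a N <= geom_mean a.
Proof.
have /andP[q0 q1] := q01.
have ge0 b K : bounded_by b K -> (forall k, 0 <= b k) -> 0 <= geom_mean b.
  move=> bK b0; rewrite -[leLHS](geom_mean_cst 0).1.
  by apply: (geom_mean_le (M := 0) _ bK) => // k; rewrite normr0.
elim: N a => [|N IH] a aM a0; have aM1 : bounded_by (fun k => a k.+1) M by move=> k; exact: aM.
  by rewrite (geom_mean_shift aM) expr0 mulr1 lerDl mulr_ge0 ?(ltW q0)// (ge0 _ M).
rewrite (geom_mean_shift aM) exprS.
have := IH _ aM1 (fun k => a0 k.+1); rewrite -(ler_pM2l q0) => H.
rewrite (_ : _ * a N.+1 = q * ((1 - q) * q ^+ N * a N.+1)); last by ring.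
by apply: (le_trans H); rewrite lerDr mulr_ge0// subr_ge0 ltW.
Qed.

(** The Taylor remainders of the terms are at most M h^2 uniformly in k, and so is their average.
    This is why bounds on second derivatives are required to differentiate once. *)
Lemma geom_mean_derivative (f f1 f2 : nat -> R -> R) M :
  (forall k, has_derivative (f k) (f1 k)) -> (forall k, has_derivative (f1 k) (f2 k)) ->
  (forall k x, `|f k x| <= M) -> (forall k x, `|f1 k x| <= M) ->
  (forall k x, `|f2 k x| <= M) ->
  has_derivative (fun x => geom_mean (f ^~ x)) (fun x => geom_mean (f1 ^~ x)).
Proof.
move=> d d1 b b1 b2 x; apply: (@quadratic_is_derive _ _ _ _ M) => h _.
have bx y : bounded_by (f ^~ y) M by move=> k; exact: b.
have b1x : bounded_by (f1 ^~ x) M by move=> k; exact: b1.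
have T k : `|f k (x + h) + (-1 * f k x + - h * f1 k x)| <= M * h ^+ 2.
  have := taylor_bound (d k) (d1 k) (fun z (_ : `|z - x| <= `|h|) => b2 k z).
  by congr (`|_| <= _); ring.
have bN : bounded_by (fun k => -1 * f k x) M by move=> k; rewrite mulN1r normrN; exact: b.
have bh : bounded_by (fun k => - h * f1 k x) (`|h| * M).
  by move=> k; rewrite normrM normrN ler_wpM2l.
have bS : bounded_by (fun k => -1 * f k x + - h * f1 k x) (M + `|h| * M).
  by move=> k; apply: le_trans (ler_normD _ _) _; apply: lerD.
have -> : geom_mean (f ^~ (x + h)) - geom_mean (f ^~ x) - h * geom_mean (f1 ^~ x) =
    geom_mean (fun k => f k (x + h) + (-1 * f k x + - h * f1 k x)).
  rewrite (geom_meanD (bx _) bS) (geom_meanD bN bh).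
  by rewrite (geom_meanZ _ (bx x)) (geom_meanZ _ b1x); ring.
exact: geom_mean_norm.
Qed.

End geometric_mean.

Section profile.
Context {R : realType}.
Implicit Types (x y h : R).

Definition clamp x : R := Num.max (-1) (Num.min 1 x).

Lemma clamp_itv x : -1 <= clamp x <= 1.
Proof. by rewrite /clamp le_max lexx/= ge_max ge_min lexx/= andbT; lra. Qed.

Lemma clamp_id x : -1 <= x <= 1 -> clamp x = x.
Proof. by move=> /andP[h1 h2]; rewrite /clamp min_r// max_r. Qed.

Lemma clamp_ge1 x : 1 <= x -> clamp x = 1.
Proof. by move=> h; rewrite /clamp min_l// max_r//; lra. Qed.

Lemma clamp_leN1 x : x <= -1 -> clamp x = -1.
Proof. by move=> h; rewrite /clamp max_l// ge_min h orbT. Qed.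

Lemma clampN x : clamp (- x) = - clamp x.
Proof.
have [h|h] := leP x (-1); first by rewrite (clamp_leN1 h) clamp_ge1 ?opprK//; lra.
have [h'|h'] := leP 1 x; first by rewrite (clamp_ge1 h') clamp_leN1//; lra.
by rewrite !clamp_id//; apply/andP; split; lra.
Qed.

Lemma clamp_incr x h : `|clamp (x + h) - clamp x| <= `|h|.
Proof.
have /andP[] : - `|h| <= h <= `|h| by rewrite -ler_norml.
move=> h5 h6; rewrite ler_norml.
have [a1|a1] := leP 1 x; have [b1|b1] := leP 1 (x + h);
  rewrite ?(clamp_ge1 a1) ?(clamp_ge1 b1).
- by apply/andP; split; lra.
- have [b2|b2] := leP (x + h) (-1).
    by rewrite (clamp_leN1 b2); apply/andP; split; lra.
  by rewrite (clamp_id (x := x + h)); [|lra]; apply/andP; split; lra.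
- have [a2|a2] := leP x (-1).
    by rewrite (clamp_leN1 a2); apply/andP; split; lra.
  by rewrite (clamp_id (x := x)); [|lra]; apply/andP; split; lra.
have [a2|a2] := leP x (-1); have [b2|b2] := leP (x + h) (-1);
  rewrite ?(clamp_leN1 a2) ?(clamp_leN1 b2).
- by apply/andP; split; lra.
- by rewrite (clamp_id (x := x + h)); [|lra]; apply/andP; split; lra.
- by rewrite (clamp_id (x := x)); [|lra]; apply/andP; split; lra.
rewrite (clamp_id (x := x + h)); [|lra]; rewrite (clamp_id (x := x)); [|lra].
by apply/andP; split; lra.
Qed.

(* The increments of [x] and [clamp x] differ only if the segment leaves [-1, 1]; then [f1 (clamp x)]
   is itself of the order of the increment, since [f1] vanishes at both ends. *)
Lemma clamp_derivative (f f1 f2 : R -> R) (M : R) :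
  has_derivative f f1 -> has_derivative f1 f2 ->
  (forall x, `|x| <= 3 -> `|f2 x| <= M) -> f1 1 = 0 -> f1 (-1) = 0 ->
  has_derivative (f \o clamp) (f1 \o clamp).
Proof.
move=> d d1 b2 e1 eN1 x.
apply: (@quadratic_is_derive _ _ _ _ (2 * M)) => h h1 /=.
have M0 : 0 <= M by apply: le_trans (b2 0 _); rewrite ?normr0.
have /andP[y1 y2] := clamp_itv x; have /andP[z1 z2] := clamp_itv (x + h).
set y := clamp x in y1 y2 *.
pose k := clamp (x + h) - y.
have kh : `|k| <= `|h| by exact: clamp_incr.
(* Points z within |k| <= 2 of y in [-1,1] satisfy |z| <= 3, whence the radius 3 in the bound on
   [f2]. *)
have T1 : `|f (y + k) - f y - k * f1 y| <= M * k ^+ 2.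
  apply: taylor_bound d d1 _ => z zk; apply: b2.
  have : `|z| <= `|z - y| + `|y| by rewrite -{1}(subrK y z) ler_normD.
  have : `|y| <= 1 by rewrite ler_norml y1.
  have : `|k| <= 2 by rewrite ler_norml /k; apply/andP; split; lra.
  lra.
have k2 : k ^+ 2 <= h ^+ 2 by rewrite -(real_normK (num_real k)) -(real_normK (num_real h)) ler_sqr ?nnegrE.
have yk : y + k = clamp (x + h) by rewrite /k; ring.
have T2 : `|(h - k) * f1 y| <= M * h ^+ 2.
  have base e : `|e| = 1 -> f1 e = 0 -> `|h - k| <= `|h| -> `|y - e| <= `|h| ->
      `|(h - k) * f1 y| <= M * h ^+ 2.
    move=> en fe hk ye; rewrite normrM -(real_normK (num_real h)) expr2 mulrCA.
    apply: ler_pM => //.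
    rewrite -[f1 y]subr0 -fe.
    apply: (@le_trans _ _ (M * `|y - e|)); last exact: ler_wpM2l.
    apply: mean_value_bound d1 _ => z ze; apply: b2.
    have := ler_normD (z - e) e; rewrite subrK en; lra.
  have [hx|hx] := leP x (-1).
    by rewrite /y (clamp_leN1 hx) eN1 mulr0 normr0 mulr_ge0// sqr_ge0.
  have [hx'|hx'] := leP 1 x.
    by rewrite /y (clamp_ge1 hx') e1 mulr0 normr0 mulr_ge0// sqr_ge0.
  have yx : y = x by apply: clamp_id; apply/andP; split; lra.
  have [hz|hz] := leP (x + h) (-1).
    apply: (base (-1)) => //; first by rewrite normrN1.
      rewrite /k (clamp_leN1 hz) yx !ler0_norm; lra.
    rewrite yx ger0_norm ?ler0_norm; lra.
  have [hz'|hz'] := leP 1 (x + h).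
    apply: (base 1) => //; first by rewrite normr1.
      rewrite /k (clamp_ge1 hz') yx !ger0_norm; lra.
    rewrite yx ler0_norm ?ger0_norm; lra.
  have -> : h - k = 0.
    by rewrite /k yx clamp_id; [ring|apply/andP; split; lra].
  by rewrite mul0r normr0 mulr_ge0// sqr_ge0.
have -> : f (clamp (x + h)) - f y - h * f1 y =
    (f (y + k) - f y - k * f1 y) - (h - k) * f1 y by rewrite yk; ring.
apply: (le_trans (ler_normB _ _)).
have : M * k ^+ 2 <= M * h ^+ 2 by exact: ler_wpM2l.
lra.
Qed.

End profile.

(** * The polynomial step *)

Section bump.
Context {R : realType}.
Implicit Types (x y : R).

(** The inverse of the integral of (1-x^2)^5 over [0,1], which is 256/693; it makes the primitive
    reach exactly 1 at x = 1. *)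
Definition bump_height : R := 693 / 256.

Definition bump_primitive x : R :=
  bump_height * (x - 5 / 3 * x ^+ 3 + 2 * x ^+ 5 - 10 / 7 * x ^+ 7 + 5 / 9 * x ^+ 9
    - x ^+ 11 / 11).

Definition bump_poly : {poly R} := bump_height%:P * (1 - 'X ^+ 2) ^+ 5.

Definition step_fun (j : nat) : R -> R :=
  if j is i.+1 then horner (bump_poly^`(i)) else bump_primitive.

Lemma has_derivative_horner (p : {poly R}) : has_derivative (horner p) (horner p^`()).
Proof.
move=> x; apply: DeriveDef; first exact: derivable_horner.
by rewrite -derive1E derivE.
Qed.

Lemma bump_polyE x : bump_poly.[x] = bump_height * (1 - x ^+ 2) ^+ 5.
Proof. by rewrite /bump_poly !hornerE. Qed.

Lemma bump_primitive_derivative : has_derivative bump_primitive (horner bump_poly).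
Proof.
move=> x; rewrite /bump_primitive; apply: is_derive_eq.
rewrite bump_polyE /GRing.scale/=.
by field.
Qed.

Lemma step_fun_derivative j : has_derivative (step_fun j) (step_fun j.+1).
Proof.
case: j => [|j] /=; first exact: bump_primitive_derivative.
exact: has_derivative_horner.
Qed.

(** Each differentiation consumes at most one factor 1-X^2. The fifth power thus leaves the
    derivatives up to order 4 of the bump, hence orders 1 to 5 of the step, vanishing at both
    ends. *)
Lemma bump_poly_derivn_dvd j : (j <= 5)%N ->
  exists r : {poly R}, bump_poly^`(j) = r * (1 - 'X ^+ 2) ^+ (5 - j).
Proof.
elim: j => [_|j IH j5]; first by exists bump_height%:P.
have [r E] := IH (ltnW j5).
have [m Em] : exists m, (5 - j = m.+1)%N by exists (5 - j.+1)%N; rewrite subnSK.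
have -> : (5 - j.+1 = m)%N by rewrite subnS Em.
rewrite derivnS E Em derivM deriv_exp /=.
exists (r^`() * (1 - 'X ^+ 2) + r * (1 - 'X ^+ 2)^`() *+ m.+1).
rewrite exprS [RHS]mulrDl; congr (_ + _); first by rewrite mulrA.
by rewrite -mulrnAl mulrA mulrnAr.
Qed.

Lemma step_fun_flat j x : (0 < j <= 5)%N -> `|x| = 1 -> step_fun j x = 0.
Proof.
case: j => // j /= j5 x1.
have [r ->] := bump_poly_derivn_dvd (ltnW j5).
have [m ->] : exists m, (5 - j = m.+1)%N by exists (5 - j.+1)%N; rewrite subnSK.
rewrite hornerM horner_exp !hornerE -real_normK ?num_real// x1.
by rewrite expr1n subrr expr0n mulr0.
Qed.

Lemma step_fun_bounded j (r : R) : exists M, forall x, `|x| <= r -> `|step_fun j x| <= M.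
Proof.
have [r0|r0] := leP 0 r; last first.
  by exists 0 => x xr; have := normr_ge0 x; lra.
have cf : {within `[- r, r], continuous (fun x => `|step_fun j x|)}.
  apply: continuous_subspaceT => x; apply: continuous_comp; last exact: norm_continuous.
  exact: (has_derivative_continuous (step_fun_derivative j)).
have rr : - r <= r by lra.
have [c _ H] := EVT_max rr cf.
by exists `|step_fun j c| => x; rewrite ler_norml => xr; apply: H; rewrite in_itv.
Qed.

Lemma bump_height_bounds : 2 <= bump_height <= 3.
Proof. by rewrite /bump_height; lra. Qed.

Lemma bump_height_ge0 : 0 <= bump_height.
Proof. by have := bump_height_bounds; lra. Qed.

(** Composition with [clamp] continues the primitive by the constants -1 and 1, and its derivatives
    by their end values 0. *)
Definition step (j : nat) x : R := step_fun j (clamp x).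

Lemma step_derivative j : (j < 5)%N -> has_derivative (step j) (step j.+1).
Proof.
move=> j5; have [M HM] := step_fun_bounded j.+2 3.
apply: (clamp_derivative (step_fun_derivative j) (step_fun_derivative j.+1) HM).
- by rewrite step_fun_flat// normr1.
- by rewrite step_fun_flat// normrN1.
Qed.

Lemma step_bounded : exists M, forall j x, (j <= 5)%N -> `|step j x| <= M.
Proof.
have b j : exists M, forall x, `|step j x| <= M.
  have [M HM] := step_fun_bounded j 1; exists M => x; apply: HM.
  by rewrite ler_norml clamp_itv.
have H n : exists M, forall j x, (j <= n)%N -> `|step j x| <= M.
  elim: n => [|n [M HM]].
    by have [M HM] := b 0%N; exists M => j x; rewrite leqn0 => /eqP ->.
  have [N HN] := b n.+1; exists (Num.max M N) => j x.
  rewrite leq_eqVlt => /predU1P[->|jn]; first by rewrite le_max HN orbT.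
  by rewrite le_max HM.
exact: H.
Qed.

Lemma step_far j x : (0 < j <= 5)%N -> 1 <= `|x| -> step j x = 0.
Proof.
move=> j5; rewrite /step ler_normr => /orP[x1|x1].
  by rewrite clamp_ge1// step_fun_flat// normr1.
by rewrite clamp_leN1 ?step_fun_flat ?normrN1//; lra.
Qed.

Lemma step1E x : step 1 x = bump_height * (1 - clamp x ^+ 2) ^+ 5.
Proof. by rewrite /step /= bump_polyE. Qed.

Lemma step0_odd x : step 0 (- x) = - step 0 x.
Proof. by rewrite /step clampN /= /bump_primitive; field. Qed.

Lemma step1_even x : step 1 (- x) = step 1 x.
Proof. by rewrite !step1E clampN sqrrN. Qed.

Lemma clamp_le x y : x <= y -> clamp x <= clamp y.
Proof.
by move=> xy; rewrite /clamp ge_max le_max lexx/= le_max le_min !ge_min lexx xy !orbT.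
Qed.

Lemma clamp_ge0 x : 0 <= x -> 0 <= clamp x.
Proof. by move=> x0; rewrite /clamp le_max le_min ler01 x0 orbT. Qed.

Lemma step1_nincr x y : 0 <= x -> x <= y -> step 1 y <= step 1 x.
Proof.
move=> x0 xy; rewrite !step1E; apply: ler_wpM2l; first exact: bump_height_ge0.
have := clamp_le xy; have := clamp_ge0 x0; have /andP[_] := clamp_itv y => h1 h2 h3.
apply: lerXn2r; rewrite ?nnegrE.
- by rewrite subr_ge0 expr_le1//; exact: le_trans h3.
- by rewrite subr_ge0 expr_le1//; exact: le_trans h1.
by rewrite lerB// ler_sqr ?nnegrE//; exact: le_trans h3.
Qed.

Lemma step1_ge0 x : 0 <= step 1 x.
Proof.
rewrite step1E; apply: mulr_ge0; first exact: bump_height_ge0.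
have /andP[h1 h2] := clamp_itv x.
by rewrite exprn_ge0// subr_ge0 -real_normK ?num_real// expr_le1// ler_norml h1.
Qed.

Lemma step1_le x : step 1 x <= bump_height.
Proof.
rewrite step1E -[leRHS]mulr1; apply: ler_wpM2l; first exact: bump_height_ge0.
have /andP[h1 h2] := clamp_itv x.
rewrite exprn_ile1//.
  by rewrite subr_ge0 -real_normK ?num_real// expr_le1// ler_norml h1.
by rewrite gerBl sqr_ge0.
Qed.

Lemma step0_homo : {homo step 0 : x y / x <= y}.
Proof.
move=> x y; rewrite le_eqVlt => /predU1P[->//|xy].
have [z [_ _ E]] := mean_value (step_derivative (isT : (0 < 5)%N)) xy.
by rewrite -subr_ge0 E mulr_ge0 ?step1_ge0// subr_ge0 ltW.
Qed.

Lemma step0_ge1 x : 1 <= x -> step 0 x = 1.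
Proof. by move=> x1; rewrite /step clamp_ge1//= /bump_primitive /bump_height; field. Qed.

Lemma step0_le1 x : step 0 x <= 1.
Proof.
have [x1|/ltW x1] := leP 1 x; first by rewrite step0_ge1.
by rewrite -(step0_ge1 (lexx 1)) step0_homo.
Qed.

Lemma step0_norm x : `|step 0 x| <= 1.
Proof. by rewrite ler_norml step0_le1 lerNl -step0_odd step0_le1. Qed.

Lemma step0_ge0 x : 0 <= x -> 0 <= step 0 x.
Proof.
move=> /step0_homo; have -> // : step 0 0 = 0.
by rewrite /step clamp_id ?lerN10 ?ler01//= /bump_primitive /bump_height; field.
Qed.

(** The value of the step at 1/2 is about 0.931; 19/20 is a rational bound that leaves room in the
    comparison of constants at L^n/2. *)
Lemma step0_half x : x <= 1 / 2 -> 1 / 20 <= 1 - step 0 x.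
Proof.
move=> x2; suff : step 0 (1 / 2) <= 19 / 20 by have := step0_homo x2; lra.
by rewrite /step clamp_id /= /bump_primitive /bump_height; lra.
Qed.

Lemma step1_half x : `|x| <= 1 / 2 -> 1 / 2 <= step 1 x.
Proof.
move=> x2; have {x2} : step 1 (1 / 2) <= step 1 x.
  have [x0|x0] := leP 0 x.
    by apply: step1_nincr => //; apply: le_trans x2; exact: ler_norm.
  rewrite -(step1_even x); apply: step1_nincr; first lra.
  by apply: le_trans x2; rewrite -normrN ler_norm.
by apply: le_trans; rewrite step1E /bump_height clamp_id; lra.
Qed.

End bump.

(** * The staircase layer *)

Section staircase.
Context {R : realType}.
Variables (p L : R).
Hypothesis p0 : 0 < p.
Hypothesis L2 : 2 <= L.
Implicit Types (x : R).

Definition stair_ratio : R := L `^ (- p).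
Local Notation q := stair_ratio.

(** The j-th derivative of x |-> step 0 (x / L^k), with the chain rule factor written out. *)
Definition stair_term (j : nat) (k : nat) x : R :=
  (L ^+ k)^-1 ^+ j * step j ((L ^+ k)^-1 * x).

Definition staircase (j : nat) x : R := geom_mean q (stair_term j ^~ x).

Let L0 : 0 < L. Proof. exact: lt_le_trans L2. Qed.
Let L1 : 1 <= L. Proof. by apply: le_trans L2; rewrite ler1n. Qed.
Let Lk0 k : 0 < L ^+ k. Proof. by rewrite exprn_gt0. Qed.
Let Lk1 k : 1 <= L ^+ k. Proof. exact: exprn_ege1. Qed.
Let iLk0 k : 0 < (L ^+ k)^-1. Proof. by rewrite invr_gt0. Qed.
Let iLk1 k : (L ^+ k)^-1 <= 1. Proof. by rewrite invf_le1. Qed.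

Lemma stair_ratio_itv : 0 < q < 1.
Proof.
rewrite /q powR_gt0//= powRN invf_lt1 ?powR_gt0//.
have <- : 1 `^ p = 1 by rewrite powR1.
by apply: gt0_ltr_powR; rewrite ?nnegrE ?(ltW L0)//; apply: lt_le_trans L2; rewrite ltr1n.
Qed.
Let q01 := stair_ratio_itv.
Let q0 : 0 < q. Proof. by case/andP: q01. Qed.
Let q1 : q < 1. Proof. by case/andP: q01. Qed.

(** Converts the weight of all scales from the k-th on into the power -p of the length L^k; every
    power law of the staircase comes from this identity. *)
Lemma stair_ratio_exp k : q ^+ k = (L ^+ k) `^ (- p).
Proof.
by rewrite -powR_mulrn ?powR_ge0// /stair_ratio -powRrM mulrC powRrM powR_mulrn ?(ltW L0).
Qed.

Lemma stair_term_derivative j k : (j < 5)%N ->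
  has_derivative (stair_term j k) (stair_term j.+1 k).
Proof.
move=> j5 x; set a := (L ^+ k)^-1.
have := has_derivative_affine a 0 (step_derivative j5 (R := R)) x.
under eq_fun do rewrite addr0; rewrite addr0 => H.
rewrite /stair_term -/a; apply: is_derive_eq.
by rewrite /GRing.scale/= exprS; ring.
Qed.

Lemma stair_term_bounded : exists M, forall j k x, (j <= 5)%N -> `|stair_term j k x| <= M.
Proof.
have [M HM] := step_bounded (R := R); exists M => j k x j5.
rewrite normrM -[leRHS]mul1r ler_pM// ?HM// normrX gtr0_norm//.
by rewrite exprn_ile1// ltW.
Qed.

Lemma staircase_derivative j : (j < 4)%N ->
  has_derivative (staircase j) (staircase j.+1).
Proof.
move=> j4; have [M HM] := stair_term_bounded.
apply: (@geom_mean_derivative _ _ q01 (stair_term j) (stair_term j.+1) (stair_term j.+2) M).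
- by move=> k; apply: stair_term_derivative; exact: ltnW.
- by move=> k; apply: stair_term_derivative.
- by move=> k x; apply: HM; exact: leq_trans (ltnW j4) _.
- by move=> k x; apply: HM; exact: leq_trans j4 _.
- by move=> k x; apply: HM.
Qed.

Lemma staircase_odd x : staircase 0 (- x) = - staircase 0 x.
Proof.
rewrite -[RHS]mulN1r -(@geom_meanZ _ _ q01 _ 1).
  congr (geom_mean _ _); apply/funext => k.
  by rewrite /stair_term !expr0 !mul1r mulrN step0_odd mulN1r.
by move=> k; rewrite /stair_term expr0 mul1r step0_norm.
Qed.

Lemma staircase_even x : staircase 1 (- x) = staircase 1 x.
Proof.
congr (geom_mean _ _); apply/funext => k.
by rewrite /stair_term mulrN step1_even.
Qed.

Lemma staircase_le1 x : `|staircase 0 x| <= 1.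
Proof.
apply: (geom_mean_norm q01) => k.
by rewrite /stair_term expr0 mul1r step0_norm.
Qed.

(** N is the least index with |x| < L^N. The steps before N are saturated at x, and minimality makes
    L^N comparable to 1+|x|. *)
Lemma scale_index x : exists N, [/\ `|x| < L ^+ N,
  (forall k, (k < N)%N -> L ^+ k <= `|x|) & L ^+ N <= L * (1 + `|x|)].
Proof.
have ex : exists n, `|x| < L ^+ n.
  exists (Num.truncn `|x|).+1; apply: lt_le_trans (truncnS_gt _) _.
  apply: (@le_trans _ _ (2 ^+ (Num.truncn `|x|).+1)).
    by rewrite -natrX ler_nat ltnW// ltn_expl.
  by apply: lerXn2r; rewrite ?nnegrE// ltW.
case: (ex_minnP ex) => N HN Hmin; exists N.
have H k : (k < N)%N -> L ^+ k <= `|x|.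
  move=> kN; rewrite leNgt; apply/negP => /Hmin.
  by rewrite leqNgt kN.
split => //.
case: N HN Hmin H => [|N] HN Hmin H.
  by rewrite expr0 -[leLHS]mul1r ler_pM// lerDl.
by rewrite exprS ler_wpM2l ?(ltW L0)//; have := H N (ltnSn N); lra.
Qed.

Lemma scaled_norm k x : `|(L ^+ k)^-1 * x| = `|x| / L ^+ k.
Proof. by rewrite normrM (gtr0_norm (iLk0 k)) mulrC. Qed.

Lemma stair_term_far j k x : (0 < j <= 5)%N -> L ^+ k <= `|x| -> stair_term j k x = 0.
Proof.
move=> j5 kx; rewrite /stair_term step_far// ?mulr0//.
by rewrite scaled_norm ler_pdivlMr// mul1r.
Qed.

(** Saturated steps have zero derivative, so only k >= N contributes. There 2 L^k >= 1+|x|, which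
    bounds the chain rule factor by (2/(1+|x|))^j, and the remaining weight q^N gives the power
    -p. *)
Lemma staircase_decay : exists2 C, 0 <= C & forall j x, (0 < j <= 4)%N ->
  `|staircase j x| <= C * (1 + `|x|) `^ (- (j%:R + p)).
Proof.
have [M HM] := step_bounded (R := R).
have M0 : 0 <= M by apply: le_trans (HM 0%N 0 isT).
exists (M * 2 ^+ 4 * 2 `^ p) => [|j x j4]; first by rewrite !mulr_ge0 ?powR_ge0.
have [N [xN Nx _]] := scale_index x.
have r0 : 0 < 1 + `|x| by rewrite ltr_wpDr.
have j5 : (0 < j <= 5)%N by case/andP: j4 => -> /leqW.
have E : `|staircase j x| <= (M * (2 / (1 + `|x|)) ^+ j) * q ^+ N.
  apply: (geom_mean_tail q01) => k kN.
    by apply: stair_term_far => //; exact: Nx.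
  rewrite normrM mulrC ler_pM//; first by apply: HM; case/andP: j5.
  rewrite normrX gtr0_norm//; apply: lerXn2r.
    by rewrite nnegrE ltW.
    by rewrite nnegrE divr_ge0// ltW.
  rewrite ler_pdivlMr// mulrC ler_pdivrMr//.
  have : L ^+ N <= L ^+ k by rewrite ler_weXn2l.
  have := Lk1 k; lra.
apply: (le_trans E).
have h1 : q ^+ N <= 2 `^ p * (1 + `|x|) `^ (- p).
  rewrite stair_ratio_exp.
  have -> : 2 `^ p * (1 + `|x|) `^ (- p) = ((1 + `|x|) / 2) `^ (- p).
    rewrite powRM ?invr_ge0// ?(ltW r0)// mulrC; congr (_ * _).
    by rewrite -powR_inv1// -powRrM mulN1r opprK.
  apply: le0_powR_nincr; [by rewrite oppr_le0 ltW|by rewrite divr_gt0|].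
  by have := Lk1 N; lra.
have h2 : (2 / (1 + `|x|)) ^+ j <= 2 ^+ 4 * (1 + `|x|) `^ (- j%:R).
  rewrite exprMn powRN powR_mulrn ?(ltW r0)// -exprVn; apply: ler_wpM2r.
    by rewrite exprn_ge0// invr_ge0 ltW.
  by apply: ler_weXn2l; [lra|case/andP: j4].
rewrite opprD powR_split//.
have -> : M * 2 ^+ 4 * 2 `^ p * ((1 + `|x|) `^ (- j%:R) * (1 + `|x|) `^ (- p)) =
  (M * (2 ^+ 4 * (1 + `|x|) `^ (- j%:R))) * (2 `^ p * (1 + `|x|) `^ (- p)) by ring.
apply: ler_pM => //.
- by rewrite mulr_ge0// exprn_ge0// divr_ge0// ltW.
- by rewrite exprn_ge0// ltW.
- exact: ler_wpM2l.
Qed.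

Lemma stair_term1_ge0 k x : 0 <= stair_term 1 k x.
Proof. by rewrite mulr_ge0 ?step1_ge0// exprn_ge0// ltW. Qed.

(** All terms are nonnegative, so the N-th alone is kept; x / L^N lies in [-1/2, 1/2], where the
    bump is at least 1/2. *)
Lemma staircase1_ge_term N x : `|x| <= L ^+ N / 2 ->
  (1 - q) / 2 * (L ^+ N) `^ (- (1 + p)) <= staircase 1 x.
Proof.
move=> xN; have [M HM] := stair_term_bounded.
have := geom_mean_ge_term q01 N (fun k => HM 1%N k x isT) (stair_term1_ge0 ^~ x).
apply: le_trans.
rewrite opprD powR_split// powR_inv1 ?(ltW (Lk0 N))// -stair_ratio_exp.
rewrite /stair_term expr1.
have h : 1 / 2 <= step 1 ((L ^+ N)^-1 * x).
  apply: step1_half; rewrite scaled_norm ler_pdivrMr// mulrC mulrA mulr1.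
  exact: xN.
have h0 : 0 <= (1 - q) * q ^+ N * (L ^+ N)^-1.
  by rewrite !mulr_ge0 ?exprn_ge0 ?subr_ge0 ?(ltW q1) ?(ltW q0) ?(ltW (iLk0 N)).
have := ler_wpM2l h0 h; lra.
Qed.

Lemma staircase_slope : exists2 c, 0 < c & forall x,
  c * (1 + `|x|) `^ (- (1 + p)) <= staircase 1 x.
Proof.
exists ((1 - q) / 2 * (L ^+ 2) `^ (- (1 + p))) => [|x].
  by rewrite mulr_gt0 ?powR_gt0// divr_gt0// subr_gt0.
have [N [xN _ Nx]] := scale_index x.
have r0 : 0 < 1 + `|x| by rewrite ltr_wpDr.
(* Passing from N to N+1 turns |x| < L^N into the half-scale condition, as L >= 2; this accounts for
   the L^2 in the constant. *)
have H : `|x| <= L ^+ N.+1 / 2.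
  rewrite exprS; have := ltW xN; have := Lk0 N; have := L2; nra.
apply: le_trans (staircase1_ge_term H).
rewrite -[leLHS]mulrA; apply: ler_wpM2l; first by rewrite divr_ge0// subr_ge0 ltW.
rewrite -powRM ?(ltW r0) ?(ltW (Lk0 2))//.
apply: le0_powR_nincr => //; first by rewrite oppr_le0 addr_ge0// ltW.
by rewrite exprS expr2 -[leRHS]mulrA ler_wpM2l// ltW.
Qed.

Lemma staircase_nincr x y : 0 <= x -> x <= y -> staircase 1 y <= staircase 1 x.
Proof.
move=> x0 xy; have [M HM] := stair_term_bounded.
apply: (geom_mean_le q01 (fun k => HM 1%N k y isT) (fun k => HM 1%N k x isT)) => k.
rewrite /stair_term ler_wpM2l ?exprn_ge0 ?(ltW (iLk0 k))//.
by apply: step1_nincr; [rewrite mulr_ge0// ltW|rewrite ler_wpM2l// ltW].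
Qed.

Lemma staircase_tailE x :
  1 - staircase 0 x = geom_mean q (fun k => 1 - stair_term 0 k x).
Proof.
have b0 k : `|-1 * stair_term 0 k x| <= 1.
  by rewrite mulN1r normrN /stair_term expr0 mul1r step0_norm.
have b1 k : `|stair_term 0 k x| <= 1 by rewrite /stair_term expr0 mul1r step0_norm.
have b2 (k : nat) : `|(1 : R)| <= 1 by rewrite normr1.
rewrite -{1}(geom_mean_cst q01 1).1 -mulN1r -(geom_meanZ q01 (-1) b1).
rewrite -(geom_meanD q01 b2 b0).
by congr (geom_mean _ _); apply/funext => k; rewrite mulN1r.
Qed.

Lemma staircase_tail_le N x : 0 <= x -> (forall k, (k < N)%N -> L ^+ k <= x) ->
  1 - staircase 0 x <= q ^+ N.
Proof.
move=> x0 Nx; rewrite staircase_tailE -[leRHS]mul1r.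
apply: le_trans (ler_norm _) _; apply: (geom_mean_tail q01) => k kN.
  rewrite /stair_term expr0 mul1r step0_ge1 ?subrr//.
  by rewrite mulrC ler_pdivlMr// mul1r Nx.
have h : 0 <= (L ^+ k)^-1 * x by rewrite mulr_ge0// ltW.
have := step0_ge0 h; have := step0_le1 ((L ^+ k)^-1 * x).
rewrite /stair_term expr0 mul1r => h1 h2; rewrite ger0_norm; lra.
Qed.

Lemma staircase_tail_ge N x : x <= L ^+ N / 2 ->
  (1 - q) / 20 * q ^+ N <= 1 - staircase 0 x.
Proof.
move=> xN; rewrite staircase_tailE.
have b k : `|1 - stair_term 0 k x| <= 2.
  have := step0_norm ((L ^+ k)^-1 * x).
  rewrite /stair_term expr0 mul1r ler_norml => /andP[h1 h2].
  by rewrite ler_norml; apply/andP; split; lra.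
have b0 k : 0 <= 1 - stair_term 0 k x by rewrite /stair_term expr0 mul1r subr_ge0 step0_le1.
apply: le_trans (geom_mean_ge_term q01 N b b0).
have h : 1 / 20 <= 1 - stair_term 0 N x.
  rewrite /stair_term expr0 [1 * step _ _]mul1r; apply: step0_half.
  by rewrite mulrC ler_pdivrMr// mulrC mulrA mulr1.
have h0 : 0 <= (1 - q) * q ^+ N.
  by rewrite mulr_ge0 ?exprn_ge0 ?subr_ge0 ?(ltW q1) ?(ltW q0).
have := ler_wpM2l h0 h; lra.
Qed.

Lemma staircase_layer : exists c C, layer p c C staircase.
Proof.
have [C C0 HC] := staircase_decay; have [c c0 Hc] := staircase_slope.
(* The tail is bounded below at the scale N+1, and L^(N+1) <= L^2 (1+x). *)
pose c' := Num.min c ((1 - q) / 20 * (L ^+ 2) `^ (- p)).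
pose C' := Num.max C (2 `^ p).
have h20 : 0 < (1 - q) / 20 by rewrite divr_gt0// subr_gt0.
exists c', C'; split => //.
- by rewrite lt_min c0 mulr_gt0// powR_gt0.
- exact: staircase_derivative.
- exact: staircase_odd.
- exact: staircase_even.
- exact: staircase_le1.
- move=> j x j4; apply: (le_trans (HC j x j4)).
  by rewrite ler_wpM2r ?powR_ge0// le_max lexx.
- move=> x; apply: le_trans (Hc x).
  by rewrite ler_wpM2r ?powR_ge0// ge_min lexx.
- exact: staircase_nincr.
move=> x x0; have [N [xN Nx NL]] := scale_index x.
rewrite (ger0_norm x0) in xN Nx NL.
have r0 : 0 < 1 + x by lra.
apply/andP; split.
  have H : x <= L ^+ N.+1 / 2 by rewrite exprS; have := Lk0 N; have := L2; nra.
  apply: le_trans (staircase_tail_ge H).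
  apply: (@le_trans _ _ ((1 - q) / 20 * (L ^+ 2) `^ (- p) * (1 + x) `^ (- p))).
    by rewrite ler_wpM2r ?powR_ge0// ge_min lexx orbT.
  rewrite -[leLHS]mulrA; apply: ler_wpM2l; first exact: ltW.
  rewrite -powRM ?(ltW r0) ?(ltW (Lk0 2))//.
  rewrite stair_ratio_exp; apply: le0_powR_nincr => //; first by rewrite oppr_le0 ltW.
  by rewrite exprS expr2 -[leRHS]mulrA ler_wpM2l// ltW.
apply: (le_trans (staircase_tail_le x0 Nx)).
apply: (@le_trans _ _ (2 `^ p * (1 + x) `^ (- p))); last first.
  by rewrite ler_wpM2r ?powR_ge0// le_max lexx orbT.
rewrite stair_ratio_exp.
have -> : 2 `^ p * (1 + x) `^ (- p) = ((1 + x) / 2) `^ (- p).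
  rewrite powRM ?invr_ge0// ?(ltW r0)// mulrC; congr (_ * _).
  by rewrite -powR_inv1// -powRrM mulN1r opprK.
apply: le0_powR_nincr; [by rewrite oppr_le0 ltW|by rewrite divr_gt0|].
by have := Lk1 N; lra.
Qed.

(** At x = L^N the step of index N has just become flat, so the sum starts at N+1; 3 bounds the
    height of the bump. *)
Lemma staircase_slope_le N : staircase 1 (L ^+ N) <= 3 * (L ^+ N.+1) `^ (- (1 + p)).
Proof.
apply: le_trans (ler_norm _) _.
rewrite opprD powR_split// powR_inv1 ?(ltW (Lk0 _))// -stair_ratio_exp mulrA.
apply: (geom_mean_tail q01) => k kN.
  apply: stair_term_far => //; rewrite gtr0_norm//.
  by rewrite ler_weXn2l.
rewrite ger0_norm ?stair_term1_ge0// /stair_term expr1 mulrC ler_pM//.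
- exact: step1_ge0.
- exact: ltW.
- by apply: (le_trans (step1_le _)); have /andP[] := bump_height_bounds (R := R).
by rewrite lef_pV2 ?posrE// ler_weXn2l.
Qed.

End staircase.

(** * The potential *)

Section potential.
Context {R : realType}.
Notation mu := (@lebesgue_measure R).
Variables (s p c C : R) (u : nat -> R -> R).
Hypothesis s01 : 0 < s < 1.
Hypothesis ps : p = s / 2.
Hypothesis lu : layer p c C u.
Implicit Types (t x y : R).

Local Notation U := (u 0%N).
Local Notation V := (frac_lap s (u 0%N)).
Local Notation V1 := (frac_lap s (u 1%N)).
Local Notation V2 := (frac_lap s (u 2%N)).

Let p0 : 0 < p. Proof. exact: layer_p_gt0 lu. Qed.
Let c0 : 0 < c. Proof. exact: layer_c_gt0 lu. Qed.
Let C0 : 0 <= C. Proof. exact: layer_C_ge0 lu. Qed.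
Let p1 : p < 1. Proof. by rewrite ps; have /andP[_ H] := s01; lra. Qed.
Let dU : has_derivative U (u 1%N). Proof. exact: (layer_derivative lu (j := 0) isT). Qed.
Let u1_gt0 x : 0 < u 1%N x. Proof. exact: layer_slope_gt0 lu x. Qed.
Let Uinj : injective U.
Proof.
move=> x y E; have [xy|yx|//] := ltgtP x y.
  by have := layer_homo_lt lu xy; rewrite E ltxx.
by have := layer_homo_lt lu yx; rewrite E ltxx.
Qed.
Let U0 : U 0 = 0.
Proof.
by have /eqP := layer_odd lu 0; rewrite oppr0 -addr_eq0 -mulr2n mulrn_eq0/= => /eqP.
Qed.

Lemma layer_frac_lap_derivative j : (j < 2)%N ->
  has_derivative (frac_lap s (u j)) (frac_lap s (u j.+1)).
Proof.
move=> j2.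
have B i y : (i <= 4)%N -> `|u i y| <= 1 + C.
  case: i => [_|i i4]; first by apply: le_trans (layer_le1 lu y) _; rewrite lerDl.
  by apply: (@le_trans _ _ C); [exact: (layer_bounded lu)|rewrite lerDr].
have j4 i : (i <= 3)%N -> (j + i <= 4)%N by move=> i3; exact: (@leq_add j i 1 3).
have d i : (i < 3)%N -> has_derivative (u (j + i)) (u (j + i).+1).
  by move=> i3; apply: (layer_derivative lu); rewrite -addnS j4.
apply: (@frac_lap_derivative _ s (u j) (u j.+1) (u j.+2) (u j.+3) (1 + C)) => //.
- by have := d 0%N isT; rewrite addn0.
- by have := d 1%N isT; rewrite addn1.
- by have := d 2%N isT; rewrite addn2.
- by move=> y; apply: B; have := j4 0%N isT; rewrite addn0.
- by move=> y; apply: B; have := j4 1%N isT; rewrite addn1.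
- by move=> y; apply: B; have := j4 2%N isT; rewrite addn2.
- by move=> y; apply: B; have := j4 3%N isT; rewrite addn3.
Qed.
Let dV : has_derivative V V1. Proof. exact: (@layer_frac_lap_derivative 0). Qed.
Let dV1 : has_derivative V1 V2. Proof. exact: (@layer_frac_lap_derivative 1). Qed.

Definition layer_inverse t : R := xget 0 [set x | U x = t].

Lemma layer_inverseK t : -1 < t < 1 -> U (layer_inverse t) = t.
Proof.
move=> /andP[t1 t2].
have [b Hb] : exists b, t < U b.
  have := layer_cvg_pinfty lu => /cvgr_gt /(_ _ t2) [b [_ Hb]].
  by exists (b + 1); apply: Hb; rewrite ltrDl.
have [a Ha] : exists a, U a < t.
  have := layer_cvg_ninfty lu => /cvgr_lt /(_ _ t1) [a [_ Ha]].
  by exists (a - 1); apply: Ha; rewrite gtrBl.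
have ab : a <= b.
  rewrite leNgt; apply/negP => /(layer_homo_lt lu) H.
  by have := lt_trans Ha (lt_trans Hb H); rewrite ltxx.
have [x _ Hx] : exists2 x, x \in `[a, b] & U x = t.
  apply: IVT => //.
    by apply: continuous_subspaceT; exact: has_derivative_continuous dU.
  rewrite ge_min le_max (ltW Ha) (ltW Hb) !orbT //.
by have /= := @xgetI _ 0 [set x | U x = t] x Hx.
Qed.

Lemma layerK : cancel U layer_inverse.
Proof. by move=> x; apply: Uinj; rewrite layer_inverseK// (layer_lt1 lu). Qed.

Lemma layer_inverse_derivative t : -1 < t < 1 ->
  is_derive t 1 layer_inverse (u 1%N (layer_inverse t))^-1.
Proof.
move=> t1; rewrite -{1}(layer_inverseK t1).
have H1 : {near layer_inverse t, cancel U layer_inverse}.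
  by near=> x; exact: layerK.
have H2 : {near layer_inverse t, continuous U}.
  by near=> x; exact: has_derivative_continuous dU x.
exact: (is_derive_inverse H1 H2 (dU _) (lt0r_neq0 (u1_gt0 _))).
Unshelve. all: by end_near. Qed.

Definition profile_force t : R := if -1 < t < 1 then V (layer_inverse t) else 0.

Definition slope_quotient x : R := V1 x / u 1%N x.

Definition profile_stiffness t : R :=
  if -1 < t < 1 then slope_quotient (layer_inverse t) else 0.

Lemma profile_forceE x : profile_force (U x) = V x.
Proof. by rewrite /profile_force (layer_lt1 lu) layerK. Qed.

Lemma layer_inverseN t : -1 < t < 1 -> layer_inverse (- t) = - layer_inverse t.
Proof.
move=> t1; apply: Uinj; rewrite (layer_odd lu) !layer_inverseK//.
by rewrite ltrN2 ltrNl andbC.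
Qed.

Lemma profile_force_odd t : profile_force (- t) = - profile_force t.
Proof.
rewrite /profile_force ltrN2 ltrNl andbC; case: ifPn => t1; last by rewrite oppr0.
by rewrite layer_inverseN// (layer_frac_lap_odd s01 lu).
Qed.

Lemma slope_quotient_even x : slope_quotient (- x) = slope_quotient x.
Proof. by rewrite /slope_quotient (layer_frac_lap_even _ lu) (layer_even lu). Qed.

Lemma profile_stiffness_even t : profile_stiffness (- t) = profile_stiffness t.
Proof.
rewrite /profile_stiffness ltrN2 ltrNl andbC; case: ifPn => // t1.
by rewrite layer_inverseN// slope_quotient_even.
Qed.

Lemma even_norm (f : R -> R) x : (forall x, f (- x) = f x) -> f x = f `|x|.
Proof. by move=> H; have [x0|x0] := leP 0 x; [rewrite ger0_norm|rewrite ltr0_norm// H]. Qed.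

Lemma layer_tail_norm x : c * (1 + `|x|) `^ (- p) <= 1 - `|U x| <= C * (1 + `|x|) `^ (- p).
Proof.
have := layer_tail lu (normr_ge0 x).
have -> : `|U x| = U `|x| => //.
have [x0|x0] := leP 0 x.
  by rewrite (ger0_norm x0) ger0_norm// -U0 (layer_homo_le lu).
by rewrite (ltr0_norm x0) (layer_odd lu) ler0_norm// -U0 (layer_homo_le lu)// ltW.
Qed.

Let r0 x : 0 < 1 + `|x|. Proof. by rewrite ltr_wpDr. Qed.

Lemma powR_natmul (r a : R) n : 0 < r -> r `^ (a *+ n) = (r `^ a) ^+ n.
Proof.
by move=> r0'; rewrite -powR_mulrn ?powR_ge0// -powRrM mulr_natr.
Qed.

(** Since 2s = 4p, the decay of L_s u corresponds to (1-|t|)^4; the square is what differentiability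
    at the wells requires. *)
Lemma profile_force_bound : exists2 K, 0 <= K & forall t,
  `|profile_force t| <= K * (1 - `|t|) ^+ 2.
Proof.
have [K K0 HK] := layer_frac_lap_bound0 s01 lu.
exists (K / c ^+ 4) => [|t]; first by rewrite divr_ge0// exprn_ge0// ltW.
rewrite /profile_force; case: ifPn => t1; last first.
  by rewrite normr0 mulr_ge0 ?divr_ge0 ?sqr_ge0 ?exprn_ge0// ltW.
set x := layer_inverse t; have /andP[h1 _] := layer_tail_norm x.
rewrite layer_inverseK// in h1.
have t0 : 0 <= 1 - `|t| <= 1.
  by rewrite subr_ge0 gerBl normr_ge0 andbT ltW// ltr_norml.
have -> : `|V x| = `|V `|x| |.
  apply: (@even_norm (fun x => `|V x|)) => y.
  by rewrite (layer_frac_lap_odd s01 lu) normrN.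
apply: (le_trans (HK _ (normr_ge0 x))).
rewrite -mulrA ler_wpM2l// ler_pdivlMl ?exprn_gt0//.
have -> : - (2 * s) = (- p) *+ 4 by rewrite ps -mulr_natr; field.
rewrite powR_natmul// -exprMn.
apply: (@le_trans _ _ ((1 - `|t|) ^+ 4)).
  apply: lerXn2r => //; rewrite nnegrE; last by case/andP: t0.
  by rewrite mulr_ge0 ?powR_ge0// ltW.
rewrite (_ : 4%N = (2 + 2)%N)// exprD; case/andP: t0 => t0 t2.
by rewrite -[leRHS]mul1r ler_wpM2r ?sqr_ge0// exprn_ile1.
Qed.

(** Inside ]-1,1[ this is the chain rule. At |t| >= 1 the function vanishes and 1 - |t+h| <= |h|, so
    the quadratic bound near the wells is already a quadratic remainder. *)
Lemma profile_force_derivative : has_derivative profile_force profile_stiffness.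
Proof.
move=> t; have [t1|t1] := boolP (-1 < t < 1).
  have D1 := layer_inverse_derivative t1.
  have D2 := dV (layer_inverse t).
  have := is_derive1_comp D2 D1.
  rewrite [profile_stiffness t]/profile_stiffness t1.
  apply: near_eq_is_derive; near=> y; rewrite /profile_force /=.
  suff -> : -1 < y < 1 by [].
  have : y \in `]-1, 1[ by near: y; apply: near_in_itvoo; rewrite in_itv.
  by rewrite in_itv.
have [K K0 HK] := profile_force_bound.
have t2 : 1 <= `|t| by move: t1; rewrite -ltr_norml -leNgt.
rewrite /profile_stiffness (negbTE t1).
apply: (@quadratic_is_derive _ _ _ _ K) => h _.
rewrite mulr0 subr0 {2}/profile_force (negbTE t1) subr0.
have [th|th] := boolP (-1 < t + h < 1); last first.
  by rewrite /profile_force (negbTE th) normr0 mulr_ge0// sqr_ge0.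
apply: (le_trans (HK _)); rewrite ler_wpM2l//.
rewrite -(real_normK (num_real h)); apply: lerXn2r; rewrite ?nnegrE//.
  by rewrite subr_ge0 ltW// ltr_norml.
have := ler_normD (t + h) (- h); rewrite addrK normrN; lra.
Unshelve. all: by end_near. Qed.

(** The arithmetic behind the exponent 5: from 2s = 4p, the exponent 1+2s of the numerator splits as
    3p + (1+p), and 1+p is cancelled by u'. *)
Lemma slope_quotient_bound : exists2 K, 0 <= K & forall x,
  `|slope_quotient x| <= K * (1 + `|x|) `^ (- (3 * p)).
Proof.
have [K K0 HK] := layer_frac_lap_bound s01 lu (isT : (0 < 1 <= 2)%N).
exists (K / c) => [|x]; first by rewrite divr_ge0// ltW.
rewrite (@even_norm (fun x => `|slope_quotient x|)); last first.
  by move=> y; rewrite slope_quotient_even.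
have := layer_slope lu `|x|; rewrite normr_id => hc.
rewrite /slope_quotient normrM normfV (gtr0_norm (u1_gt0 _)) ler_pdivrMr//.
apply: (le_trans (HK _ (normr_ge0 x))).
apply: (@le_trans _ _ (K / c * (1 + `|x|) `^ (- (3 * p)) * (c * (1 + `|x|) `^ (- (1 + p))))).
  have -> : - (1 + 2 * s) = - (3 * p) + - (1 + p) by rewrite ps; field.
  rewrite powR_split// le_eqVlt; apply/orP; left; apply/eqP; field.
  exact: lt0r_neq0.
by rewrite ler_wpM2l// mulr_ge0 ?powR_ge0// divr_ge0// ltW.
Qed.

Definition slope_quotient_deriv x : R := (V2 x * u 1%N x - V1 x * u 2%N x) / u 1%N x ^+ 2.

Lemma slope_quotient_derivative : has_derivative slope_quotient slope_quotient_deriv.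
Proof.
move=> x; have H1 := dV1 x; have H2 := layer_derivative lu (isT : (1 < 4)%N) x.
have H3 := is_deriveV (lt0r_neq0 (u1_gt0 x)) H2.
apply: is_derive_eq.
rewrite /GRing.scale/= /slope_quotient_deriv; field.
exact: lt0r_neq0.
Qed.

(** The bounds on (L_s u)'' and (L_s u)' have the same power, so no decay is gained over the
    quotient itself. Divided by u' this only bounds W''' by a growing power (1+x)^(1-2p), hence
    Hölder rather than Lipschitz continuity of W''. *)
Lemma slope_quotient_deriv_bound : exists2 K, 0 <= K & forall x, 0 <= x ->
  `|slope_quotient_deriv x| <= K * (1 + x) `^ (- (3 * p)).
Proof.
have [K1 K10 HK1] := layer_frac_lap_bound s01 lu (isT : (0 < 1 <= 2)%N).
have [K2 K20 HK2] := layer_frac_lap_bound s01 lu (isT : (0 < 2 <= 2)%N).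
exists (K2 / c + K1 * C / c ^+ 2) => [|x x0].
  by rewrite addr_ge0 ?divr_ge0 ?mulr_ge0 ?exprn_ge0// ltW.
have hr : 0 < 1 + x by lra.
have := layer_slope lu x; rewrite (ger0_norm x0) => hc.
have h2 := layer_decay lu x (isT : (0 < 2 <= 4)%N); rewrite (ger0_norm x0) in h2.
set a := (1 + x) `^ (- (1 + p)) in hc.
set b := (1 + x) `^ (- (3 * p)).
have a0 : 0 < a by exact: powR_gt0.
have b0 : 0 < b by exact: powR_gt0.
have E : (1 + x) `^ (- (1 + 2 * s)) = b * a.
  by rewrite /a /b -powR_split//; congr (_ `^ _); rewrite ps; field.
have E2 : (1 + x) `^ (- (2%:R + p)) <= a.
  apply: ler_powR; [lra|have := p0; lra].
have i0 : 0 < (u 1%N x)^-1 by rewrite invr_gt0.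
have ic : (u 1%N x)^-1 <= (c * a)^-1 by rewrite lef_pV2 ?posrE// mulr_gt0.
have B1 := HK1 x x0; have B2 := HK2 x x0; rewrite !E in B1 B2.
have -> : slope_quotient_deriv x =
    V2 x * (u 1%N x)^-1 - V1 x * u 2%N x * ((u 1%N x)^-1 * (u 1%N x)^-1).
  by rewrite /slope_quotient_deriv; field; exact: lt0r_neq0.
apply: (le_trans (ler_normB _ _)); rewrite mulrDl; apply: lerD.
  rewrite normrM (gtr0_norm i0).
  apply: (@le_trans _ _ ((K2 * (b * a)) * (c * a)^-1)); first by rewrite ler_pM// ltW.
  rewrite le_eqVlt; apply/orP; left; apply/eqP; field.
  by rewrite !lt0r_neq0.
rewrite !normrM (gtr0_norm i0).
apply: (@le_trans _ _ ((K1 * (b * a)) * (C * a) * ((c * a)^-1 * (c * a)^-1))).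
  apply: ler_pM; rewrite ?mulr_ge0 ?(ltW i0)//.
    apply: ler_pM => //; apply: (le_trans h2); exact: ler_wpM2l.
  by rewrite ler_pM// ltW.
rewrite le_eqVlt; apply/orP; left; apply/eqP; field.
by rewrite !lt0r_neq0.
Qed.

End potential.

(** * Hölder continuity and two-sided bounds for the second derivative of the potential *)

Section well.
Context {R : realType}.
Notation mu := (@lebesgue_measure R).
Variables (s p c C : R) (u : nat -> R -> R).
Hypothesis s01 : 0 < s < 1.
Hypothesis ps : p = s / 2.
Hypothesis lu : layer p c C u.
Implicit Types (t x y : R).

Local Notation U := (u 0%N).
Local Notation V := (frac_lap s (u 0%N)).
Local Notation g := (profile_force s u).
Local Notation D := (profile_stiffness s u).
Local Notation E := (slope_quotient s u).
Local Notation inv := (layer_inverse u).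

Let p0 : 0 < p. Proof. exact: layer_p_gt0 lu. Qed.
Let c0 : 0 < c. Proof. exact: layer_c_gt0 lu. Qed.
Let C0 : 0 <= C. Proof. exact: layer_C_ge0 lu. Qed.
Let p1 : p < 1 / 2. Proof. by rewrite ps; have /andP[_ H] := s01; lra. Qed.
Let dU : has_derivative U (u 1%N). Proof. exact: (layer_derivative lu (j := 0) isT). Qed.
Let dg : has_derivative g D. Proof. exact: profile_force_derivative s01 ps lu. Qed.
Let r0 x : 0 < 1 + `|x|. Proof. by rewrite ltr_wpDr. Qed.

Let U0 : U 0 = 0.
Proof.
by have /eqP := layer_odd lu 0; rewrite oppr0 -addr_eq0 -mulr2n mulrn_eq0/= => /eqP.
Qed.

Lemma layer_inverse_homo t1 t2 : -1 < t1 < 1 -> -1 < t2 < 1 -> t1 <= t2 ->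
  inv t1 <= inv t2.
Proof.
move=> h1 h2 t12; rewrite leNgt; apply/negP => /(layer_homo_lt lu).
by rewrite !(layer_inverseK lu)// ltNge t12.
Qed.

Lemma layer_inverse_ge0 t : 0 <= t < 1 -> 0 <= inv t.
Proof.
move=> /andP[t0 t1]; have h0 : inv 0 = 0 by rewrite -{1}U0 (layerK lu).
rewrite -h0; apply: layer_inverse_homo => //; first by rewrite ltrN10 ltr01.
by rewrite t1 (lt_le_trans _ t0)// ltrN10.
Qed.

(* With [r = 1 + x], over an increment [d <= 1] of [x] the quotient varies by at most
   [r^(-3p) d], and [t = U x] by at least [r^(-1-p) d]. *)
Definition holder_exponent : R := 3 * p / (1 + p).
Local Notation th := holder_exponent.

Lemma holder_exponent_itv : 0 < th <= 1.
Proof.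
have H := p1; have H0 := p0; rewrite /th divr_gt0/=; [|lra|lra].
by rewrite ler_pdivrMr; lra.
Qed.
Let th0 : 0 < th. Proof. by case/andP: holder_exponent_itv. Qed.
Let th1 : th <= 1. Proof. by case/andP: holder_exponent_itv. Qed.

(** The hypotheses on d describe min(1, y-x). A short increment is handled by the derivative, a long
    one by the size of the quotient at both ends. *)
Lemma slope_quotient_increment : exists2 K, 0 <= K & forall x y d, 0 <= x -> x <= y ->
  0 <= d -> d <= 1 -> (d < 1 -> d = y - x) ->
  `|E y - E x| <= K * ((1 + x) `^ (- (3 * p)) * d).
Proof.
have [K1 K10 HK1] := slope_quotient_bound s01 ps lu.
have [K2 K20 HK2] := slope_quotient_deriv_bound s01 ps lu.
exists (2 * K1 + K2) => [|x y d x0 xy d0 d1 hd]; first by rewrite addr_ge0// mulr_ge0.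
have mono z : x <= z -> (1 + z) `^ (- (3 * p)) <= (1 + x) `^ (- (3 * p)).
  by move=> xz; apply: le0_powR_nincr; have := p0; lra.
have b0 := powR_ge0 (1 + x) (- (3 * p)).
have [d1'|d1'] := ltP d 1; last first.
  have -> : d = 1 by apply/eqP; rewrite eq_le d1.
  rewrite mulr1 mulrDl; apply: (le_trans (ler_normB _ _)).
  have := HK1 x; have := HK1 y; rewrite (ger0_norm x0) (ger0_norm (le_trans x0 xy)).
  have := ler_wpM2l K10 (mono y xy); have := mulr_ge0 K20 b0; lra.
have {}hd := hd d1'.
move: xy; rewrite le_eqVlt => /predU1P[xy|xy].
  by rewrite xy subrr normr0 mulr_ge0 ?addr_ge0 ?mulr_ge0 ?powR_ge0.
have [z [xz zy ->]] := mean_value (slope_quotient_derivative s01 lu) xy.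
rewrite -hd normrM (ger0_norm d0) mulrA ler_wpM2r//.
have z0 : 0 <= z by lra.
apply: (le_trans (HK2 z z0)).
have := ler_wpM2l K20 (mono z (ltW xz)).
have := mulr_ge0 (mulr_ge0 (ler0n R 2) K10) b0; lra.
Qed.

(** By monotonicity only the initial piece [x, x+d] is kept; for z in it, d <= 1 gives 1+z <=
    2(1+x). *)
Lemma layer_increment x y d : 0 <= x -> x <= y -> 0 <= d -> d <= 1 ->
  (d < 1 -> d = y - x) -> (d <= y - x) ->
  c * 2 `^ (- (1 + p)) * ((1 + x) `^ (- (1 + p)) * d) <= U y - U x.
Proof.
move=> x0 xy d0 d1 hd dyx.
move: d0; rewrite le_eqVlt => /predU1P[<-|d0].
  by rewrite !mulr0 subr_ge0 (layer_homo_le lu).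
have [z [xz zd Ez]] := mean_value dU (ltr_pwDr d0 (lexx x)).
apply: (@le_trans _ _ (U (x + d) - U x)); last first.
  by rewrite lerD2r (layer_homo_le lu)//; lra.
rewrite Ez addrAC subrr add0r mulrA ler_wpM2r//; first exact: ltW.
apply: le_trans (layer_slope lu z).
rewrite -mulrA ler_wpM2l//; first exact: ltW.
rewrite -powRM//; last by lra.
have := p0 => H; apply: le0_powR_nincr; first by lra.
  by have := normr_ge0 z; lra.
by rewrite ger0_norm; lra.
Qed.

Lemma stiffness_holder_inside : exists2 K, 0 <= K & forall t1 t2,
  0 <= t1 -> t1 <= t2 -> t2 < 1 -> `|D t2 - D t1| <= K * (t2 - t1) `^ th.
Proof.
have [K K0 HK] := slope_quotient_increment.
pose m := c * 2 `^ (- (1 + p)).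
have m0 : 0 < m by rewrite mulr_gt0// powR_gt0.
exists (K * (m `^ th)^-1) => [|t1 t2 t10 t12 t21].
  by rewrite mulr_ge0// invr_ge0 powR_ge0.
have i1 : -1 < t1 < 1 by apply/andP; split; lra.
have i2 : -1 < t2 < 1 by apply/andP; split; lra.
rewrite /profile_stiffness i1 i2.
set x := inv t1; set y := inv t2.
have x0 : 0 <= x by apply: layer_inverse_ge0; rewrite t10; lra.
have xy : x <= y by exact: layer_inverse_homo.
pose d := Num.min 1 (y - x).
have d1 : d <= 1 by rewrite ge_min lexx.
have d0 : 0 <= d by rewrite le_min ler01 subr_ge0.
have dyx : d <= y - x by rewrite ge_min lexx orbT.
have hd : d < 1 -> d = y - x by rewrite /d gt_min ltxx/= => h; rewrite min_r// ltW.
apply: (le_trans (HK x y d x0 xy d0 d1 hd)).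
have := layer_increment x0 xy d0 d1 hd dyx; rewrite -/m /x /y !(layer_inverseK lu)// -/x -/y => HU.
rewrite -mulrA ler_wpM2l// ler_pdivlMl ?powR_gt0//.
(* The exponent is tuned so that r^(-(1+p)) raised to it is r^(-3p), with r = 1+x; and d is at most
   its own power because d <= 1 and the exponent is at most 1. *)
apply: (@le_trans _ _ ((m * ((1 + x) `^ (- (1 + p)) * d)) `^ th)); last first.
  apply: ge0_ler_powR => //; rewrite ?nnegrE ?subr_ge0//; first exact: ltW.
  by rewrite !mulr_ge0 ?powR_ge0// ltW.
rewrite powRM; [|exact: ltW|by rewrite mulr_ge0 ?powR_ge0].
rewrite ler_wpM2l ?powR_ge0//.
rewrite powRM ?powR_ge0// -powRrM.
have -> : - (1 + p) * th = - (3 * p).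
  by rewrite /th; field; have := p0 => H; rewrite lt0r_neq0//; lra.
rewrite ler_wpM2l ?powR_ge0//.
move: d0; rewrite le_eqVlt => /predU1P[<-|d0]; first exact: powR_ge0.
by apply: ger1_powR; rewrite ?d0.
Qed.

Lemma layer_tail_pow x (n : nat) : (1 + `|x|) `^ (- p) ^+ n <= ((1 - `|U x|) / c) ^+ n.
Proof.
have /andP[h _] := layer_tail_norm lu x.
have h2 : (1 + `|x|) `^ (- p) <= (1 - `|U x|) / c by rewrite ler_pdivlMr// mulrC.
apply: lerXn2r => //; rewrite nnegrE ?powR_ge0//.
exact: le_trans h2.
Qed.

Let pow3 x : (1 + `|x|) `^ (- (3 * p)) = (1 + `|x|) `^ (- p) ^+ 3.
Proof. by rewrite -powR_natmul//; congr (_ `^ _); rewrite -mulr_natr; ring. Qed.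

Lemma stiffness_upper : exists2 K, 0 < K & forall t, `|t| <= 1 ->
  `|D t| <= K * (1 - `|t|) ^+ 3.
Proof.
have [K K0 HK] := slope_quotient_bound s01 ps lu.
(* K is only known to be nonnegative; adding 1 makes the constant positive. *)
exists ((K + 1) / c ^+ 3) => [|t t1].
  by rewrite divr_gt0 ?exprn_gt0//; lra.
have K1 : 0 <= (K + 1) / c ^+ 3 by rewrite divr_ge0 ?exprn_ge0//; [lra|exact: ltW].
rewrite /profile_stiffness; case: ifPn => ti; last first.
  by rewrite normr0 mulr_ge0 ?exprn_ge0// subr_ge0.
apply: (le_trans (HK _)); rewrite pow3.
have := layer_tail_pow (inv t) 3; rewrite (layer_inverseK lu)// exprMn exprVn => H.
apply: (@le_trans _ _ ((K + 1) * (1 + `|inv t|) `^ (- p) ^+ 3)).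
  by rewrite ler_wpM2r ?exprn_ge0 ?powR_ge0// lerDl.
rewrite -mulrA ler_wpM2l//; [lra|].
by rewrite mulrC.
Qed.

(** If t2 lies beyond the well, [D t2] is 0 and the cubic upper bound at t1 is dominated by the
    required power of 1-t1 <= t2-t1. Points of opposite sign are reduced to this half by evenness
    and | |t1|-|t2| | <= |t1-t2|. *)
Lemma stiffness_holder : exists C', forall t1 t2, `|D t1 - D t2| <= C' * `|t1 - t2| `^ th.
Proof.
have [K K0 HK] := stiffness_holder_inside; have [K1 K10 HK1] := stiffness_upper.
exists (K + K1).
have nn t1 t2 : 0 <= t1 -> t1 <= t2 -> `|D t2 - D t1| <= (K + K1) * (t2 - t1) `^ th.
  move=> t10 t12; have P0 := powR_ge0 (t2 - t1) th.
  have [t21|t21] := ltP t2 1.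
    apply: (le_trans (HK _ _ t10 t12 t21)); rewrite ler_wpM2r//; lra.
  have -> : D t2 = 0 by rewrite /profile_stiffness [t2 < 1]ltNge t21 andbF.
  have [t11|t11] := ltP t1 1; last first.
    have -> : D t1 = 0 by rewrite /profile_stiffness [t1 < 1]ltNge t11 andbF.
    by rewrite subrr normr0 mulr_ge0//; lra.
  rewrite sub0r normrN.
  have n1 : `|t1| <= 1 by rewrite ger0_norm// ltW.
  apply: (le_trans (HK1 _ n1)); rewrite ger0_norm//.
  apply: (@le_trans _ _ (K1 * (t2 - t1) `^ th)); last by rewrite ler_wpM2r//; lra.
  rewrite ler_wpM2l ?(ltW K10)//.
  apply: (@le_trans _ _ ((1 - t1) `^ th)); last first.
    by apply: ge0_ler_powR; rewrite ?nnegrE ?(ltW th0)//; lra.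
  apply: (@le_trans _ _ (1 - t1)); last by apply: ger1_powR => //; lra.
  by rewrite exprS ler_piMr ?exprn_ile1//; lra.
move=> t1 t2.
have Dn t : D t = D `|t| by apply: even_norm; exact: profile_stiffness_even lu.
have KK : 0 <= K + K1 by lra.
have H : `|D `|t1| - D `|t2| | <= (K + K1) * `| `|t1| - `|t2| | `^ th.
  have [h|h] := leP `|t1| `|t2|.
    by rewrite distrC [X in X `^ _]distrC [X in X `^ _]ger0_norm ?subr_ge0//; exact: nn.
  by rewrite [X in X `^ _]ger0_norm ?subr_ge0 ?(ltW h)//; apply: nn => //; exact: ltW.
rewrite (Dn t1) (Dn t2); apply: (le_trans H); rewrite ler_wpM2l//.
apply: ge0_ler_powR; rewrite ?nnegrE ?(ltW th0)//.
exact: ler_dist_dist.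
Qed.

Lemma stiffness_lower : exists k m, [/\ 0 < k, 0 < m < 1 &
  forall t, 1 - m <= `|t| -> `|t| < 1 -> k * (1 - `|t|) ^+ 3 <= D t].
Proof.
have [k [X [k0 X0 HX]]] := layer_frac_lap_lower s01 lu.
have C1 : 0 < C.
  rewrite lt_def C0 andbT; apply/eqP => C00.
  have := layer_tail_norm lu 0; rewrite C00 mul0r => /andP[h1 h2].
  by have := le_trans h1 h2; rewrite leNgt mulr_gt0// powR_gt0.
(* The well neighbourhood is chosen so that |t| >= 1-m forces u^(-1)(|t|) >= X, where the lower
   bound for (L_s u)' holds. *)
pose m := Num.min (1 / 2) (1 - U X).
have mX : 1 - m >= U X by rewrite lerBrDl -lerBrDr ge_min lexx orbT.
have m2 : 0 < m < 1.
  have /andP[_ h] := layer_lt1 lu X.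
  by rewrite lt_min gt_min; apply/andP; split; [apply/andP; split|apply/orP; left]; lra.
(* C^3 comes from comparing (1-|t|)^3 with the tail, one more C from the upper bound on u'. *)
exists (k / C ^+ 4), m; split => //; first by rewrite divr_gt0// exprn_gt0.
move=> t tm t1.
rewrite (even_norm t (profile_stiffness_even _ lu)).
have /andP[_ m1] := m2.
have ti : -1 < `|t| < 1 by rewrite t1 andbT (lt_le_trans _ (normr_ge0 t))// ltrN10.
rewrite /profile_stiffness ti.
set x := inv `|t|.
have xX : X <= x.
  rewrite leNgt; apply/negP => /(layer_homo_lt lu).
  by rewrite (layer_inverseK lu)//; lra.
have x0 : 0 <= x by lra.
have hr : 0 < 1 + x by lra.
rewrite /slope_quotient ler_pdivlMr ?(layer_slope_gt0 lu)//.
apply: le_trans (HX x xX).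
have hu : u 1%N x <= C * (1 + x) `^ (- (1 + p)).
  apply: le_trans (ler_norm _) _.
  by have := layer_decay lu x (isT : (0 < 1 <= 4)%N); rewrite (ger0_norm x0).
have /andP[_ ht] := layer_tail_norm lu x.
rewrite (layer_inverseK lu)// normr_id (ger0_norm x0) in ht.
have t1' : 0 <= 1 - `|t| by lra.
have ht3 : (1 - `|t|) ^+ 3 <= C ^+ 3 * (1 + x) `^ (- (3 * p)).
  have -> : (1 + x) `^ (- (3 * p)) = (1 + x) `^ (- p) ^+ 3.
    by have := pow3 x; rewrite (ger0_norm x0).
  by rewrite -exprMn; apply: lerXn2r => //; rewrite nnegrE// (le_trans t1' ht).
have -> : - (1 + 2 * s) = - (3 * p) + - (1 + p) by rewrite ps; field.
rewrite powR_split//.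
apply: (@le_trans _ _ ((k / C ^+ 4) * (C ^+ 3 * (1 + x) `^ (- (3 * p))) *
  (C * (1 + x) `^ (- (1 + p))))).
  have kC : 0 <= k / C ^+ 4 by rewrite divr_ge0 ?exprn_ge0// ltW.
  apply: ler_pM => //; first by rewrite mulr_ge0// exprn_ge0.
    by rewrite ltW// (layer_slope_gt0 lu).
  by rewrite ler_wpM2l.
rewrite le_eqVlt; apply/orP; left; apply/eqP; field.
exact: lt0r_neq0.
Qed.

End well.

(** * Recovering the potential from its derivative *)

Section double_well.
Context {R : realType}.
Notation mu := (@lebesgue_measure R).
Implicit Types (t x y : R).

Lemma primitive_of_supported (g : R -> R) : continuous g ->
  (forall t, t <= -1 -> g t = 0) ->
  exists W, has_derivative W g /\ forall t, t <= -1 -> W t = 0.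
Proof.
move=> cg g0.
(* Starting at -2 rather than -1 makes t = -1 an interior point for the fundamental theorem of
   calculus; the integral over [-2,-1] vanishes. *)
pose W t := \int[mu]_(y in `[-2, t]) g y.
have W0 t : t <= -1 -> W t = 0.
  move=> t1; rewrite /W (@eq_Rintegral _ _ _ _ _ (fun=> 0)).
    by rewrite Rintegral_cst ?mul0r.
  by move=> y; rewrite inE/= in_itv/= => /andP[_ yt]; apply: g0; lra.
exists W; split => // t.
have [t1|t1] := ltP t (-1).
  rewrite (g0 _ (ltW t1)).
  have H := is_derive_cst (0 : R) t 1.
  apply: near_eq_is_derive H.
  near=> y; rewrite W0// ltW//.
  by near: y; exact: lt_nbhsl.
have ig : mu.-integrable `[-2, t + 1] (EFin \o g).
  apply: continuous_compact_integrable; first exact: segment_compact.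
  exact: continuous_subspaceT.
have t2 : -2 < t by lra.
have tt : t < t + 1 by rewrite ltrDl.
have [d e] := @continuous_FTC1_closed R g (-2) t (t + 1) tt ig t2 (cg t).
by apply: DeriveDef; [exact: d|rewrite -derive1E; exact: e].
Unshelve. all: by end_near. Qed.

(** An odd derivative gives an even W, so the value 0 at -1 is inherited at 1. The sign of [g] on
    [-1,0] is only known in the weak sense; strict positivity of W is created near -1 by D > 0 and
    propagated by monotonicity up to 0. *)
Lemma double_well (g D : R -> R) (m : R) : has_derivative g D ->
  (forall t, g (- t) = - g t) -> (forall t, t <= -1 -> g t = 0) ->
  (forall t, -1 <= t -> t <= 0 -> 0 <= g t) ->
  0 < m < 1 -> (forall t, -1 < t -> t < -1 + m -> 0 < D t) ->
  exists W, [/\ has_derivative W g, forall t, 0 <= W t,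
    W 1 = 0, W (-1) = 0 & forall t, -1 < t < 1 -> 0 < W t].
Proof.
move=> dg og g0 gp /andP[m0 m1] Dp.
have [W [dW W0]] := primitive_of_supported (has_derivative_continuous dg) g0.
have Wmono a b : a <= b -> b <= 0 -> W a <= W b.
  rewrite le_eqVlt => /predU1P[->//|ab] b0.
  have [z [az zb E]] := mean_value dW ab.
  rewrite -subr_ge0 E mulr_ge0 ?subr_ge0 ?(ltW ab)//.
  have [z1|z1] := leP (-1) z; first by apply: gp => //; lra.
  by rewrite g0// ltW.
have We t : W (- t) = W t.
  (* The difference W(y) - W(-y) has zero derivative and vanishes at 0; the affine form matches the
     chain rule lemma. *)
  pose f y := W y - W (-1 * y + 0).
  have df : has_derivative f (fun=> 0).
    move=> y; have H1 := dW y; have H2 := has_derivative_affine (-1) 0 dW y.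
    rewrite /f; apply: is_derive_eq.
    by rewrite !mulN1r addr0 og !opprK subrr.
  have F a b : a < b -> f a = f b.
    by move=> /(mean_value df)[z [_ _ /eqP]]; rewrite mul0r subr_eq0 => /eqP ->.
  have f0 : f t = f 0 by have [/F|/F|->] := ltgtP t 0.
  by move: f0; rewrite /f !mulN1r !addr0 oppr0 subrr => /subr0_eq ->.
have gpos t : -1 < t -> t < -1 + m -> 0 < g t.
  move=> t1 tm; have [z [z1 zt E]] := mean_value dg t1.
  have g1 : g (-1) = 0 by exact: g0.
  suff : 0 < g t - g (-1) by rewrite g1 subr0.
  rewrite E mulr_gt0 ?subr_gt0//.
  by apply: Dp => //; exact: lt_trans tm.
have Wpos t : -1 < t -> t <= 0 -> 0 < W t.
  move=> t1 t0.
  pose y := Num.min t (-1 + m / 2).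
  have y1 : -1 < y by rewrite lt_min t1/=; lra.
  have ym : y < -1 + m by rewrite gt_min; apply/orP; right; lra.
  have [z [z1 zy E]] := mean_value dW y1.
  have W1 : W (-1) = 0 by exact: W0.
  apply: (@lt_le_trans _ _ (W y)); last by apply: Wmono => //; rewrite ge_min lexx.
  suff : 0 < W y - W (-1) by rewrite W1 subr0.
  rewrite E mulr_gt0 ?subr_gt0//.
  by apply: gpos => //; exact: lt_trans ym.
have Wge t : t <= 0 -> 0 <= W t.
  move=> t0; have [t1|t1] := leP t (-1); first by rewrite W0.
  by rewrite ltW// Wpos.
exists W; split => //.
- move=> t; have [t0|t0] := leP t 0; first exact: Wge.
  by rewrite -We; apply: Wge; lra.
- by rewrite -We W0.
- exact: W0.
- move=> t /andP[t1 t2]; have [t0|t0] := leP t 0; first exact: Wpos.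
  by rewrite -We; apply: Wpos; lra.
Qed.

End double_well.

(** * Oscillation of the staircase *)

Section staircase_hits.
Context {R : realType}.
Variables (p L : R).
Hypothesis p01 : 0 < p <= 1.
Hypothesis L3 : 3 <= L.
Hypothesis q100 : stair_ratio p L <= 1 / 100.
Local Notation q := (stair_ratio p L).

Let p0 : 0 < p. Proof. by case/andP: p01. Qed.
Let L2 : 2 <= L. Proof. by have := L3; lra. Qed.
Let L0 : 0 < L. Proof. by have := L3; lra. Qed.
Let Lk0 k : 0 < L ^+ k. Proof. by rewrite exprn_gt0. Qed.
Let q0 : 0 < q. Proof. exact: powR_gt0. Qed.

Lemma crossing (f : R -> R) (a b v : R) : a <= b ->
  (forall x, a <= x -> {for x, continuous f}) -> f b <= v <= f a ->
  exists x, [/\ a <= x, x <= b & f x = v].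
Proof.
move=> ab cf /andP[h1 h2].
have [x + E] : exists2 x, x \in `[a, b] & f x = v.
  apply: IVT => //; last by rewrite ge_min le_max h1 h2 orbT.
  by apply: continuous_in_subspaceT => x /[!inE]/=; rewrite in_itv/= => /andP[/cf].
by rewrite in_itv/= => /andP[ax xb]; exists x.
Qed.

(** The intermediate value theorem applied to f(x) x^a, which lies above q at L^n/2 and below q at
    L^n. *)
Lemma powR_crossing (f : R -> R) (a : R) n : continuous f ->
  f (L ^+ n) <= q * (L ^+ n) `^ (- a) ->
  q * (L ^+ n / 2) `^ (- a) <= f (L ^+ n / 2) ->
  exists x, [/\ L ^+ n / 2 <= x, x <= L ^+ n & f x = q * x `^ (- a)].
Proof.
move=> cf h1 h2; have Ln := Lk0 n.
have L20 : 0 < L ^+ n / 2 by rewrite divr_gt0.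
have H x : 0 < x -> x `^ (- a) * x `^ a = 1.
  by move=> x0; rewrite -powR_split// addNr powRr0.
have [x [x1 x2 E]] : exists x, [/\ L ^+ n / 2 <= x, x <= L ^+ n & f x * x `^ a = q].
  apply: (@crossing (fun x => f x * x `^ a)); first lra.
    move=> x hx; apply: cvgM; first exact: cf.
    by apply: powR_continuous_at; exact: lt_le_trans hx.
  apply/andP; split.
    have := ler_wpM2r (powR_ge0 (L ^+ n) a) h1.
    by rewrite -mulrA H// mulr1.
  have := ler_wpM2r (powR_ge0 (L ^+ n / 2) a) h2.
  by rewrite -[q * _ * _]mulrA H// mulr1.
exists x; split => //; have x0 : 0 < x := lt_le_trans L20 x1.
by rewrite -E -mulrA (mulrC (x `^ a)) H// mulr1.
Qed.

Let half_le (a : R) n : 0 <= a <= 2 -> (L ^+ n / 2) `^ (- a) <= 4 * (L ^+ n) `^ (- a).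
Proof.
move=> /andP[a0 a2].
rewrite powRM ?invr_ge0 ?(ltW (Lk0 n))// mulrC ler_wpM2r ?powR_ge0//.
rewrite -powR_inv1// -powRrM mulN1r opprK.
have -> : 4 = 2 `^ 2 :> R by rewrite powR_mulrn//; ring.
by apply: ler_powR => //; lra.
Qed.

(** At L^n the steps 0 to n are saturated, so 1-u <= q^(n+1) = q (L^n)^(-p). At L^n/2 the n-th step
    still contributes (1-q) q^n / 20, while the target is at most 4 q q^n; q <= 1/100 makes 4q <=
    (1-q)/20. *)
Lemma staircase_hit n : exists x, [/\ L ^+ n / 2 <= x, x <= L ^+ n &
  1 - staircase p L 0 x = q * x `^ (- p)].
Proof.
have Q := q100; have Q0 := q0; have P := p01.
have q01 : 0 < q < 1 by apply/andP; split; lra.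
apply: powR_crossing.
- move=> x; apply: cvgB; first exact: cvg_cst.
  exact: (has_derivative_continuous (staircase_derivative p0 L2 (isT : (0 < 4)%N))).
- rewrite -(stair_ratio_exp _ L2) -exprS; apply: (staircase_tail_le p0 L2) => [|k kn].
    exact: ltW.
  by rewrite ler_weXn2l//; have := L3; lra.
apply: le_trans (staircase_tail_ge p0 L2 (lexx _)).
have b0 := powR_ge0 (L ^+ n) (- p).
have P2 : 0 <= p <= 2 by lra.
have := ler_wpM2l (ltW Q0) (half_le n P2).
rewrite (stair_ratio_exp _ L2); nra.
Qed.

(** At L^n the slope is at most 3 (L^(n+1))^(-(1+p)) = (3/L) q (L^n)^(-(1+p)), which is why L >= 3
    is assumed. At L^n/2 the comparison is 4q <= (1-q)/2. *)
Lemma staircase_slope_hit n : exists x, [/\ L ^+ n / 2 <= x, x <= L ^+ n &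
  staircase p L 1 x = q * x `^ (- (1 + p))].
Proof.
have Q := q100; have Q0 := q0; have P := p01.
apply: powR_crossing.
- exact: (has_derivative_continuous (staircase_derivative p0 L2 (isT : (1 < 4)%N))).
- apply: (le_trans (staircase_slope_le p0 L2 n)).
  rewrite exprS powRM ?(ltW L0) ?(ltW (Lk0 n))// mulrA ler_wpM2r ?powR_ge0//.
  rewrite opprD powR_split// powR_inv1 ?(ltW L0)// mulrA -/q.
  rewrite -[leRHS]mul1r ler_wpM2r ?(ltW Q0)// ler_pdivrMr// mul1r.
  exact: L3.
apply: le_trans (staircase1_ge_term p0 L2 _); last first.
  by rewrite ger0_norm// divr_ge0// ltW.
have b0 := powR_ge0 (L ^+ n) (- (1 + p)).
have P2 : 0 <= 1 + p <= 2 by lra.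
have := ler_wpM2l (ltW Q0) (half_le n P2).
nra.
Qed.

End staircase_hits.

(** * Choice of the parameters and assembly *)

Unset Implicit Arguments.

Lemma D1E (f df : RR -> RR) : has_derivative f df -> D1 f = df.
Proof.
move=> H; apply/funext => x; have [d e] := H x.
by rewrite /D1 derive1E; exact: e.
Qed.

Lemma has_derivative_dble (f df : RR -> RR) t : has_derivative f df -> dble f t.
Proof. by move=> H; have [d _] := H t; exact: d. Qed.

Lemma exists_layer (s : RR) : 0 < s < 1 ->
  exists (u : nat -> RR -> RR) (c C q : RR) (xs zs : nat -> RR),
    [/\ layer (s / 2) c C u, 0 < q, (forall k, 2 ^+ k / 2 <= xs k),
        (forall k, 2 ^+ k / 2 <= zs k) &
        forall k, 1 - u 0%N (xs k) = q * xs k `^ (- (s / 2)) /\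
                  u 1%N (zs k) = q * zs k `^ (- (1 + s / 2))].
Proof.
move=> /andP[s0 s1].
pose p : RR := s / 2; have p0 : 0 < p by rewrite /p; lra.
have p1 : p <= 1 by rewrite /p; lra.
(* This choice makes q exactly 1/100, and p <= 1 gives L >= 100. *)
pose L : RR := 100 `^ p^-1.
have L100 : 100 <= L.
  apply: le1r_powR; first by lra.
  by rewrite invf_ge1.
have qE : stair_ratio p L = 1 / 100.
  by rewrite /stair_ratio /L -powRrM mulrN mulVf ?lt0r_neq0// powR_inv1// div1r.
have L2 : 2 <= L by lra.
have L3 : 3 <= L by lra.
have q100 : stair_ratio p L <= 1 / 100 by rewrite qE.
have p01 : 0 < p <= 1 by rewrite p0.
have [c [C lu]] := staircase_layer p0 L2.
have [xs Hx] := choice (staircase_hit p01 L3 q100).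
have [zs Hz] := choice (staircase_slope_hit p01 L3 q100).
have L2k k : 2 ^+ k / 2 <= L ^+ k / 2.
  by rewrite ler_wpM2r// lerXn2r ?nnegrE//; lra.
exists (staircase p L), c, C, (stair_ratio p L), xs, zs; split => //.
- by rewrite qE; lra.
- by move=> k; have [h _ _] := Hx k; exact: le_trans h.
- by move=> k; have [h _ _] := Hz k; exact: le_trans h.
- by move=> k; have [_ _ h1] := Hx k; have [_ _ h2] := Hz k.
Qed.

Lemma doubling_cvgy (xs : nat -> RR) : (forall k, 2 ^+ k / 2 <= xs k) ->
  (forall k, 0 < xs k) /\ xs @ \oo --> +oo.
Proof.
move=> H; split.
  by move=> k; apply: lt_le_trans (H k); rewrite divr_gt0// exprn_gt0.
apply/cvgryPge => A; near=> k; apply: le_trans (H k).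
have h : A * 2 <= k%:R by near: k; exact: nbhs_infty_ger.
rewrite ler_pdivlMr//; apply: (le_trans h).
by rewrite -natrX ler_nat ltnW// ltn_expl.
Unshelve. all: by end_near. Qed.

Theorem theorem1p5 (s : RR) (hs : 0 < s < 1) :
  exists (W : RR -> RR) (u : RR -> RR),
    (forall t, 0 <= W t) /\
    (* (W1) *)
    (exists theta : RR, 0 < theta /\ C2theta_loc theta W) /\
    W 1 = 0 /\ W (-1) = 0 /\ D1 W 1 = 0 /\ D1 W (-1) = 0 /\
    (* (W2) *)
    (forall t, -1 < t < 1 -> 0 < W t) /\
    (* (W3) with the exponent constraints *)
    (exists (c1 c2 c3 c4 mu alpha beta gamma delta : RR),
       0 < c1 <= c2 /\ 0 < c3 <= c4 /\ 0 < mu < 1 /\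
       2 <= beta <= alpha /\ 2 <= delta <= gamma /\
       (forall t, -1 < t <= -1 + mu ->
          c1 * (1 + t) `^ (alpha - 2) <= D2 W t <= c2 * (1 + t) `^ (beta - 2)) /\
       (forall t, 1 - mu <= t < 1 ->
          c3 * (1 - t) `^ (gamma - 2) <= D2 W t <= c4 * (1 - t) `^ (delta - 2)) /\
       Num.max (alpha - beta) (gamma - delta) < 1 /\
       5 <= Num.min beta delta /\
       (* the solution *)
       classX u /\
       (forall x, Ls_PV_at s u x (D1 W (u x))) /\
       (* asymptotics *)
       (exists (C1 C2 : RR) (xs ys zs : nat -> RR),
          0 < C1 /\ 0 < C2 /\
          (forall k, 0 < xs k) /\ (forall k, 0 < ys k) /\ (forall k, 0 < zs k) /\
          xs @ \oo --> +oo /\ ys @ \oo --> +oo /\ zs @ \oo --> +oo /\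
          (forall k,
             1 - u (xs k) = C2 * xs k `^ (- (2 * s / (gamma - 1))) /\
             1 - u (ys k) = C1 * ys k `^ (- (2 * s / (delta - 1))) /\
             1 + u (- xs k) = C2 * `|xs k| `^ (- (2 * s / (alpha - 1))) /\
             1 + u (- ys k) = C1 * `|ys k| `^ (- (2 * s / (beta - 1))) /\
             dble u (zs k) /\ dble u (- zs k) /\
             D1 u (zs k) =
               C1 * zs k `^ (- (1 + 2 * s * (gamma - delta + 1) / (gamma - 1))) /\
             D1 u (- zs k) =
               C1 * `|zs k| `^ (- (1 + 2 * s * (alpha - beta + 1) / (alpha - 1)))))).
Proof.
have /andP[s0 s1] := hs.
have [u [c [C [q [xs [zs [lu q0 hx hz hits]]]]]]] := exists_layer s hs.
have ps : s / 2 = s / 2 :> RR by [].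
pose g := profile_force s u; pose D := profile_stiffness s u.
have dg : has_derivative g D by exact: (profile_force_derivative hs ps lu).
have [K1 [m [k0 m01 Hlow]]] := stiffness_lower hs ps lu.
have [K2 K20 Hup] := stiffness_upper hs ps lu.
have gN t : g (- t) = - g t by exact: (profile_force_odd hs lu).
have g0 t : t <= -1 -> g t = 0.
  by move=> t1; rewrite /g /profile_force [-1 < t]ltNge t1.
have gp t : -1 <= t -> t <= 0 -> 0 <= g t.
  (* By oddness the claim is moved to -t >= 0, where L_s u is nonpositive on the corresponding
     half-line. *)
  move=> t1 t0; rewrite -[t]opprK gN oppr_ge0 /g /profile_force.
  case: ifPn => // ti.
  apply: (layer_frac_lap_le0 hs lu); apply: (layer_inverse_ge0 lu).
  by have /andP[_ ->] := ti; rewrite oppr_ge0 t0.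
have Dlow t : -1 < t -> t <= -1 + m -> K1 * (1 + t) ^+ 3 <= D t.
  have /andP[m0 m1] := m01.
  move=> t1 tm; have tn : `|t| = - t by rewrite ltr0_norm//; lra.
  by have := Hlow t; rewrite tn opprK; apply; lra.
have Dpos t : -1 < t -> t < -1 + m -> 0 < D t.
  move=> t1 tm; apply: lt_le_trans (Dlow t t1 (ltW tm)).
  by rewrite mulr_gt0// exprn_gt0//; lra.
have [W [dW W0 W1 WN1 Wp]] := double_well dg gN g0 gp m01 Dpos.
have DW : D1 W = g := D1E _ _ dW.
have DDW : D2 W = D by rewrite /D2 DW; exact: D1E dg.
have dU := layer_derivative lu (j := 0) isT.
have DU : D1 (u 0%N) = u 1%N := D1E _ _ dU.
have [xs0 xsy] := doubling_cvgy _ hx; have [zs0 zsy] := doubling_cvgy _ hz.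
have cU : continuous (u 0%N) := has_derivative_continuous dU.
have e3 : 5 - 2 = 3%:R :> RR by ring.
have Dbound t : 1 - m <= `|t| -> `|t| < 1 ->
    K1 * (1 - `|t|) `^ (5 - 2) <= D2 W t <= K2 * (1 - `|t|) `^ (5 - 2).
  move=> t1 t2; rewrite e3 powR_mulrn ?subr_ge0 ?(ltW t2)// DDW Hlow//=.
  by apply: le_trans (ler_norm _) _; apply: Hup; exact: ltW.
(* The lower and upper bounds are compared at t = 1-m, where the common power is positive. *)
have K12 : K1 <= K2.
  have /andP[m0 m1] := m01.
  have n : `|1 - m| = 1 - m by rewrite ger0_norm; lra.
  have := Dbound (1 - m); rewrite n => /(_ (lexx _))/(_ _)/wrap[]; first lra.
  move=> /andP[h1 h2]; have := le_trans h1 h2; rewrite ler_pM2r//.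
  by apply: powR_gt0; lra.
exists W, (u 0%N); split; [exact: W0|split].
  have [th0 _] := andP (holder_exponent_itv hs ps lu).
  exists (holder_exponent (s / 2)); split => //; split.
    by move=> t; exact: has_derivative_dble dW.
  split; first by move=> t; rewrite DW; exact: has_derivative_dble dg.
  move=> a b; have [C' HC] := stiffness_holder hs ps lu.
  by exists C' => t1 t2 _ _; rewrite DDW; exact: HC.
do 2 (split; first by []).
rewrite DW; split; first by rewrite -[1]opprK gN g0// oppr0.
split; first by rewrite g0.
split; first exact: Wp.
(* W'' is even, so both wells share the same constants. *)
exists K1, K2, K1, K2, m, 5, 5, 5, 5.
split; first by rewrite k0.
split; first by rewrite k0.
split; first by [].
split; first by rewrite lexx andbT; lra.
split; first by rewrite lexx andbT; lra.
have /andP[m0 m1] := m01.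
split.
  move=> t /andP[t1 tm].
  have tn : `|t| = - t by rewrite ltr0_norm//; lra.
  by have := Dbound t; rewrite tn opprK; apply; lra.
split.
  move=> t /andP[t1 tm].
  have tn : `|t| = t by rewrite ger0_norm//; lra.
  by have := Dbound t; rewrite tn; apply.
split; first by rewrite subrr maxxx ltr01.
split; first by rewrite minxx.
split.
  split; last by split; [exact: layer_cvg_pinfty lu|exact: layer_cvg_ninfty lu].
  move=> a b; apply: continuous_compact_integrable; first exact: segment_compact.
  exact: continuous_subspaceT.
split.
  move=> x; have -> : g (u 0%N x) = frac_lap s (u 0%N) x by exact: profile_forceE lu x.
  have B y : `|u 0%N y| <= 1 by exact: layer_le1 lu y.
  split.
    move=> e e0.
    exact: (integral_outside x s0 e0 cU (layer_homo_le lu) B).1.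
  apply: (principal_value (A := 2 * C) (B := 1) hs cU (layer_homo_le lu) B) => h.
  apply: diff2_quadratic dU (layer_derivative lu (j := 1) isT) _ => z _.
  exact: (layer_bounded lu).
have e1 : 2 * s / (5 - 1) = s / 2 by field.
have e2 : 1 + 2 * s * (5 - 5 + 1) / (5 - 1) = 1 + s / 2 by field.
(* With equal exponents the identities at [xs] and [ys] coincide, so one sequence serves for both;
   the values at negative points follow since u is odd and u' even. *)
exists q, q, xs, xs, zs; do 8 (split; first by []).
move=> k; have [h1 h2] := hits k.
rewrite !e1 !e2 DU !(layer_odd lu) !(layer_even lu) !gtr0_norm//.
do 4 (split; first by []).
by split; [exact: has_derivative_dble dU|split; [exact: has_derivative_dble dU|]].
Qed.
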